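(* Let $m\ge 2$ and let $G=\langle t,x,y\mid t^{2^m}=1,\ x^2=y^2=1,\ t\text{ central},\ (x,y)=t^{2^{m-1}}\rangle$ be a group of type $\mathcal{D}_1$. Then the rational group algebra $\mathbb{Q}G$ is the direct sum of $4m$ fields and one quaternion algebra. Let $K$ be a finite field of odd order $q$. Then the Wedderburn decomposition of $KG$ contains at least $8m-10$ simple components, the minimal number being achieved if $q\equiv 3\pmod 8$, in which case the decomposition of $KG$ consists of $8m-12$ fields and two quaternion algebras, each necessarily a ring of $2\times 2$ matrices.
   Context: $(x,y)$ denotes the group commutator of $x$ and $y$. The group $G$ has order $4\cdot 2^m$, its elements being uniquely of the form $t^ix^\delta y^\epsilon$ with $0\le i<2^m$ and $\delta,\epsilon\in\{0,1\}$; ''type $\mathcal{D}_1$'' means given by the displayed presentation. A quaternion algebra means a $4$-dimensional central simple algebra over its centre (a field extension of the ground field); $2\times2$ matrix rings over fields are included. ''Direct sum'' means direct sum of algebras (the Wedderburn decomposition), and the simple components are the simple algebras appearing in it.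
   Formalization: The last clause (minimal number achieved for q ≡ 3 mod 8, with 8m−12 fields and two quaternion algebras) is stated only for m ≥ 3; at m = 2 it is false, since KG is then 8 fields and one quaternion algebra. *)

(* Defs.v *)
From HB Require Import structures.
From mathcomp Require Export all_boot all_order all_algebra all_fingroup all_field.

Set Implicit Arguments.
Unset Strict Implicit.
Unset Printing Implicit Defensive.

Import GRing.Theory.
Local Open Scope ring_scope.

(* The group algebra K[gT]: the function a : gT -> K stands for the formal sum *)
(* of the a g * g, and the product is convolution.                            *)
Definition group_alg (K : fieldType) (gT : finGroupType) := {ffun gT -> K^o}.

Section GroupAlgebra.

Variables (K : fieldType) (gT : finGroupType).
Local Notation KG := (group_alg K gT).

HB.instance Definition _ := Vector.copy KG {ffun gT -> K^o}.

Implicit Types (a b c : KG) (g h : gT).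

Definition group_alg_one : KG := [ffun g => (g == 1%g)%:R].
Definition group_alg_mul a b : KG :=
  [ffun g => \sum_h a h * b (h^-1 * g)%g].

Fact group_alg_mulA : associative group_alg_mul.
Proof.
move=> a b c; apply/ffunP=> g; rewrite !ffunE.
under eq_bigr do rewrite ffunE mulr_sumr.
under [in RHS]eq_bigr do rewrite ffunE mulr_suml.
rewrite [RHS]exchange_big /=; apply: eq_bigr => h _.
rewrite [RHS](reindex (mulg h)) /=; last first.
  by exists (mulg h^-1%g) => k _; rewrite ?mulKg ?mulKVg.
by apply: eq_bigr => k _; rewrite mulKg invMg mulgA mulrA.
Qed.

Fact group_alg_mul1l : left_id group_alg_one group_alg_mul.
Proof.
move=> a; apply/ffunP=> g; rewrite ffunE (bigD1 1%g) //= big1 => [|h /negPf nh].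
  by rewrite ffunE eqxx mul1r invg1 mul1g addr0.
by rewrite ffunE nh mul0r.
Qed.

Fact group_alg_mul1r : right_id group_alg_one group_alg_mul.
Proof.
move=> a; apply/ffunP=> g; rewrite ffunE (bigD1 g) //= big1 => [|h nh].
  by rewrite ffunE mulVg eqxx mulr1 addr0.
by rewrite ffunE -(inj_eq (mulgI h)) mulKVg mulg1 eq_sym (negPf nh) mulr0.
Qed.

Fact group_alg_mulDl : left_distributive group_alg_mul +%R.
Proof.
move=> a b c; apply/ffunP=> g; rewrite !ffunE -big_split /=.
by apply: eq_bigr => h _; rewrite ffunE mulrDl.
Qed.

Fact group_alg_mulDr : right_distributive group_alg_mul +%R.
Proof.
move=> a b c; apply/ffunP=> g; rewrite !ffunE -big_split /=.
by apply: eq_bigr => h _; rewrite ffunE mulrDr.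
Qed.

Fact group_alg_one_neq0 : group_alg_one != 0.
Proof. by apply/eqP=> /ffunP/(_ 1%g)/eqP; rewrite !ffunE eqxx oner_eq0. Qed.

HB.instance Definition _ := GRing.Zmodule_isNzRing.Build KG
  group_alg_mulA group_alg_mul1l group_alg_mul1r
  group_alg_mulDl group_alg_mulDr group_alg_one_neq0.

Fact group_alg_scaleAl (k : K) a b : k *: (a * b) = (k *: a) * b.
Proof.
apply/ffunP=> g; rewrite !ffunE scaler_sumr.
by apply: eq_bigr => h _; rewrite ffunE scalerAl.
Qed.
HB.instance Definition _ := GRing.Lmodule_isLalgebra.Build K KG
  group_alg_scaleAl.

Fact group_alg_scaleAr (k : K) a b : k *: (a * b) = a * (k *: b).
Proof.
apply/ffunP=> g; rewrite !ffunE scaler_sumr.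
by apply: eq_bigr => h _; rewrite ffunE scalerAr.
Qed.
HB.instance Definition _ := GRing.Lalgebra_isAlgebra.Build K KG
  group_alg_scaleAr.

HB.instance Definition _ := Algebra_isFalgebra.Build K KG.

End GroupAlgebra.

Section Wedderburn.

Variables (K : fieldType) (A : falgType K).

Definition two_sided_ideal (I : {vspace A}) : bool :=
  ({:A} * I <= I)%VS && (I * {:A} <= I)%VS.

Definition simple_alg : Prop :=
  forall I : {vspace A}, two_sided_ideal I -> I = 0%VS \/ I = {:A}%VS.

Definition field_alg : Prop :=
  commutative (@GRing.mul A) /\ GRing.field_axiom A.

(* The centre of a simple algebra is a field Z, over which the algebra is      *)
(* central simple, so only its dimension over Z, dim_K A / dim_K Z, remains    *)
(* to be prescribed.                                                           *)
Definition quaternion_alg : Prop :=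
  simple_alg /\ \dim {:A} = (4 * \dim 'Z({:A})%VS)%N.

(* 'M[L]_2 has no canonical K-algebra structure, hence the last clause.        *)
Definition matrix2_alg : Prop :=
  exists (L : fieldExtType K) (f : {rmorphism 'M[L]_2 -> A}),
    bijective f /\ forall (k : K) (M : 'M[L]_2), f (k%:A *: M) = k *: f M.

End Wedderburn.

(* An {aspace A} is closed under products and has its own identity element,    *)
(* usually not that of A; subvs_of B is B as an algebra with that identity.    *)
Definition wedderburn_decomposition (K : fieldType) (A : falgType K)
    (s : seq {aspace A}) : Prop :=
  [/\ (\sum_(B <- s) B)%VS = {:A}%VS,
      directv (\sum_(B <- s) B)%VS,
      forall B : {aspace A}, B \in s -> two_sided_ideal B
    & forall B : {aspace A}, B \in s -> simple_alg (subvs_of B)].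

(* Main.v *)
(* Put z = t^(2^(m-1)), a central involution. Since X^(2^m) - 1 is separable,
   its factorization into irreducibles f splits 1 into orthogonal central
   idempotents e_f, polynomials in t. If f divides X^(2^(m-1)) - 1, then z acts
   as 1 on the ideal of e_f, so x and y commute there, and the four choices of
   signs for x and y cut it into four copies of the field K[X]/(f). If f divides
   X^(2^(m-1)) + 1, then z acts as -1, x and y anticommute, and the ideal is
   M_2(K[X]/(f)), with matrix units y^i (1 + x)/2 y^j. The number of components
   is therefore four times the number of irreducible factors of X^(2^(m-1)) - 1
   plus the number of those of X^(2^(m-1)) + 1.

   Over Q each X^(2^k) + 1 is a cyclotomic polynomial, hence irreducible. Over a
   finite field of odd order it is reducible for k >= 2, because -1, 2 or -2 is
   a square; if q = 3 mod 8 it has exactly two factors, since a root lies in an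
   extension of degree d only if 2^(k+1) divides q^d - 1, which forces 2^(k-1)
   to divide d. *)
Require Import Defs.
From HB Require Import structures.
From mathcomp Require Import cyclic ring zify.
Set Implicit Arguments.
Unset Strict Implicit.
Unset Printing Implicit Defensive.
Import GRing.Theory.
Local Open Scope ring_scope.

(** * Wedderburn decompositions and central idempotents *)

Lemma two_sided_idealP (K : fieldType) (A : falgType K) (I : {vspace A}) :
  reflect (forall a u, u \in I -> a * u \in I /\ u * a \in I)
          (two_sided_ideal I).
Proof.
apply: (iffP andP) => [[/prodvP lI /prodvP rI] a u Iu | idI].
  by split; [apply: lI; rewrite ?memvf | apply: rI; rewrite ?memvf].
by split; apply/prodvP=> a b; [move=> _ /(idI a)[] | move=> /(idI b)[]].
Qed.

Section Ideals.

Variables (K : fieldType) (A : falgType K).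
Implicit Types (I J : {vspace A}) (B C : {aspace A}).

Lemma two_sided_ideal_cap I J :
  two_sided_ideal I -> two_sided_ideal J -> two_sided_ideal (I :&: J).
Proof.
move=> /two_sided_idealP idI /two_sided_idealP idJ; apply/two_sided_idealP.
move=> a u /memv_capP[/idI-/(_ a)[? ?] /idJ-/(_ a)[? ?]].
by rewrite !memv_cap; split; apply/andP.
Qed.

(** The preimage of [I] under the inclusion of [B] into [A] is a two-sided ideal of [subvs_of B], to
    which simplicity applies. *)
Lemma simple_block_minimal B I : simple_alg (subvs_of B) ->
  two_sided_ideal I -> (I <= B)%VS -> I = 0%VS \/ I = B.
Proof.
move=> simB /two_sided_idealP idI sIB.
pose v : 'Hom(subvs_of B, A) := linfun vsval.
have vE w : v w = vsval w by rewrite lfunE.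
have /simB : two_sided_ideal (v @^-1: I).
  by apply/two_sided_idealP=> a u; rewrite -!memv_preim !vE; apply: idI.
have pre b (Ib : b \in I) : vsproj B b \in (v @^-1: I)%VS.
  by rewrite -memv_preim vE vsprojK // (subvP sIB).
case=> defJ; [left | right].
  apply/eqP; rewrite -subv0; apply/subvP=> b Ib; move: (pre b Ib).
  rewrite defJ !memv0 => /eqP/(congr1 vsval).
  by rewrite vsprojK ?(subvP sIB) // => ->.
apply/eqP; rewrite eqEsubv sIB; apply/subvP=> b Bb.
have: vsproj B b \in (v @^-1: I)%VS by rewrite defJ memvf.
by rewrite -memv_preim vE vsprojK.
Qed.

Lemma wedderburn_uniq (s : seq {aspace A}) : wedderburn_decomposition s -> uniq s.
Proof.
case=> _ dx _ _; elim: s dx => //= B s IHs.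
rewrite directvE /= !big_cons => /eqP dimBs.
have leS : (\dim (\sum_(C <- s) C) <= \sum_(C <- s) \dim C)%N by apply: dimv_leq_sum.
have leB := dimv_add_leqif B (\sum_(C <- s) C)%VS.
have /IHs-> : directv (\sum_(C <- s) C)%VS.
  rewrite directvE /= eqn_leq leS -(leq_add2l (\dim B)) -dimBs.
  exact: leB.
rewrite andbT; apply/negP=> Bs; have sBs: (B <= \sum_(C <- s) C)%VS.
  by rewrite (big_rem B) //= addvSl.
move: leS; rewrite -(addv_idPr sBs) dimBs -[X in (_ <= X)%N]add0n.
by rewrite leq_add2r leqNgt adim_gt0.
Qed.

(** Since 1 is a sum of elements of the blocks in [s2], the product B * C is nonzero for some such
    [C]. It lies in the ideal [B :&: C], which by minimality equals both blocks. This uniqueness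
    carries a count from one decomposition to all. *)
Lemma wedderburn_sub (s1 s2 : seq {aspace A}) :
  wedderburn_decomposition s1 -> wedderburn_decomposition s2 -> {subset s1 <= s2}.
Proof.
move=> [_ _ id1 sim1] [sum2 _ id2 sim2] B Bs1.
have [C Cs2 nzBC]: exists2 C, C \in s2 & (B * C)%VS != 0%VS.
  apply/hasP; apply: contraT => /hasPn BC0.
  have: algid B * 1 \in (B * \sum_(C <- s2) C)%VS.
    by rewrite memv_mul ?memv_algid // sum2 memvf.
  rewrite mulr1 big_distrr /= big_seq big1 => [|C /BC0]; last by rewrite negbK => /eqP.
  by rewrite memv0 (negPf (algid_neq0 _)).
have sub : (B * C <= B :&: C)%VS.
  have /two_sided_idealP idB := id1 _ Bs1; have /two_sided_idealP idC := id2 _ Cs2.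
  by apply/prodvP=> b c Bb Cc; rewrite memv_cap;
     case: (idB c _ Bb) (idC b _ Cc) => _ -> [-> _].
have idI := two_sided_ideal_cap (id1 _ Bs1) (id2 _ Cs2).
have nzI : (B :&: C)%VS <> 0%VS.
  by move=> I0; move: sub; rewrite I0 subv0 (negPf nzBC).
have [//|defB] := simple_block_minimal (sim1 _ Bs1) idI (capvSl _ _).
have [//|defC] := simple_block_minimal (sim2 _ Cs2) idI (capvSr _ _).
suff ->: B = C by [].
by apply: val_inj; rewrite /= -defB.
Qed.

Lemma wedderburn_perm (s1 s2 : seq {aspace A}) :
  wedderburn_decomposition s1 -> wedderburn_decomposition s2 -> perm_eq s1 s2.
Proof.
move=> w1 w2; apply: uniq_perm; try exact: wedderburn_uniq.
by move=> B; apply/idP/idP; apply: wedderburn_sub.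
Qed.

Definition central_idem (e : A) : Prop :=
  [/\ e != 0, e * e = e & forall a, a * e = e * a].

Lemma central_idem_is_aspace (e : A) :
  central_idem e -> is_aspace (limg (amull e)).
Proof.
case=> nz_e ee cen; apply/andP; split.
  apply/has_algidP; exists e; split=> // [|_ /memv_imgP[a _ ->]].
    by apply/memv_imgP; exists 1; rewrite ?memvf // lfunE /= mulr1.
  by rewrite !lfunE /= cen !mulrA ee.
apply/prodvP=> _ _ /memv_imgP[a _ ->] /memv_imgP[b _ ->].
apply/memv_imgP; exists (a * (e * b)); rewrite ?memvf //.
by rewrite !lfunE /= !mulrA.
Qed.

(* The default value {:A} is junk, for e not a central idempotent. *)
Definition block (e : A) : {aspace A} := insubd {:A}%AS (limg (amull e)).

Lemma memv_block e : central_idem e -> forall a, (a \in block e) = (e * a == a).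
Proof.
move=> ide a; have [nz_e ee cen] := ide.
rewrite /block /= val_insubd central_idem_is_aspace //.
apply/memv_imgP/eqP=> [[b _ ->] | <-]; first by rewrite lfunE /= mulrA ee.
by exists a; rewrite ?memvf // lfunE.
Qed.

Lemma algid_block e : central_idem e -> algid (block e) = e.
Proof.
move=> ide; have [nz_e ee cen] := ide.
have Be : e \in block e by rewrite memv_block // ee.
rewrite -[RHS](algidl Be) cen; apply/esym/eqP.
by rewrite -memv_block // memv_algid.
Qed.

Lemma block_ideal e : central_idem e -> two_sided_ideal (block e).
Proof.
move=> ide; have [nz_e ee cen] := ide; apply/two_sided_idealP=> a u.
by rewrite !memv_block // => /eqP eu; rewrite !mulrA -cen -mulrA !eu !eqxx.
Qed.

(** Serves to transport relations between generators of [A] to the block. *)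
Lemma block_proj e : central_idem e ->
  {f : {lrmorphism A -> subvs_of (block e)} | forall a, vsval (f a) = e * a}.
Proof.
move=> ide; have [nz_e ee cen] := ide.
pose f a := vsproj (block e) (e * a).
have fE a : vsval (f a) = e * a by rewrite vsprojK // memv_block // mulrA ee.
have fL : linear f by move=> k a b; rewrite /f mulrDr -scalerAr linearP.
have fM : monoid_morphism f.
  split; first by apply: val_inj; rewrite /= fE algid_block // mulr1.
  by move=> a b; apply: val_inj; rewrite /= !fE !mulrA -(mulrA e a) cen !mulrA ee.
pose mL := GRing.isLinear.Build K A (subvs_of (block e)) _ f fL.
pose mM := GRing.isMonoidMorphism.Build A (subvs_of (block e)) f fM.
pose F : {lrmorphism A -> subvs_of (block e)} := HB.pack f mL mM.
by exists F.
Qed.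

Section OrthogonalIdempotents.

Variables (I : finType) (E : I -> A).
Hypothesis nzE : forall i, E i != 0.
Hypothesis cenE : forall i a, a * E i = E i * a.
Hypothesis orthE : forall i j, i != j -> E i * E j = 0.
Hypothesis sumE : \sum_i E i = 1.

Lemma orth_central_idem i : central_idem (E i).
Proof.
split=> //; rewrite -[RHS]mulr1 -sumE mulr_sumr (bigD1 i) //= big1 ?addr0 //.
by move=> j nij; rewrite orthE // eq_sym.
Qed.

(** The order [r] of the indices is left to the caller, so that blocks of one kind can precede those
    of another. Directness follows on multiplying a vanishing sum by [E i]. *)
Lemma wedderburn_of_idems (r : seq I) : perm_eq r (enum I) ->
    (forall i, simple_alg (subvs_of (block (E i)))) ->
  wedderburn_decomposition [seq block (E i) | i <- r].
Proof.
move=> r_I simE; have ide := orth_central_idem.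
have rE (U : I -> {vspace A}) : (\sum_(i <- r) U i = \sum_i U i)%VS.
  by rewrite (perm_big _ r_I) big_enum.
split.
- rewrite big_map rE; apply/eqP; rewrite eqEsubv subvf; apply/subvP=> a _.
  rewrite -[a]mul1r -sumE mulr_suml; apply: memv_sumr => i _.
  by rewrite memv_block // mulrA; case: (ide i) => _ ->.
- have: directv (\sum_i block (E i))%VS.
    apply/directv_sum_independent=> us Bus sum0 i _.
    move/(congr1 ( *%R (E i))): sum0; rewrite mulr0 mulr_sumr (bigD1 i) //= big1.
      by rewrite addr0; move: (Bus i isT); rewrite memv_block // => /eqP->.
    move=> j nji; have:= Bus j isT; rewrite memv_block // => /eqP <-.
    by rewrite mulrA orthE ?mul0r // eq_sym.
  rewrite !directvE /= !big_map rE => /eqP->.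
  by rewrite (perm_big _ r_I) big_enum.
- by move=> _ /mapP[i _ ->]; apply: block_ideal.
by move=> _ /mapP[i _ ->].
Qed.

End OrthogonalIdempotents.

End Ideals.

(** * Algebras generated by a root and two anticommuting involutions *)

(* linearP does not apply: horner_alg is declared linear for the scaling
   k%:A * _ instead of k *: _. *)
Lemma horner_alg_linear (K : fieldType) (A : algType K) (a : A) (k : K)
    (p q : {poly K}) :
  horner_alg a (k *: p + q) = k *: horner_alg a p + horner_alg a q.
Proof. by rewrite linearP /= mulr_algl. Qed.

(** Evaluation at [a] factors through [L], a copy of K[X]/(f): a polynomial vanishing at the root
    [z] of [f] in [L] is not coprime to [f], by Bezout, hence is a multiple of [f] and vanishes at
    [a]. *)
Lemma irredp_lift (K : fieldType) (f : {poly K}) : irreducible_poly f ->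
  exists L : fieldExtType K, forall (R : algType K) (a : R),
    horner_alg a f = 0 ->
    exists2 rho : {lrmorphism L -> R},
      forall q : {poly K}, exists l, rho l = horner_alg a q
      & forall l, exists q : {poly K}, rho l = horner_alg a q.
Proof.
move=> irr_f; have [L _ [z fz0 defL]] := irredp_FAdjoin irr_f.
exists L => R a fa0; have fz : horner_alg z f = 0 by apply/eqP.
have onto l : {q : {poly K} | horner_alg z q == l}.
  apply: sigW; have: l \in <<1; z>>%VS by rewrite defL memvf.
  by case/Fadjoin_polyP=> _ /polyOver1P[q ->] ->; exists q.
have ker (q : {poly K}) : horner_alg z q = 0 -> horner_alg a q = 0.
  move=> qz0; have [_ irr] := irr_f.
  have [/Bezout_eq1_coprimepP[[u v] /= uv]|] := boolP (coprimep f q).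
    have /eqP := congr1 (horner_alg z) uv.
    by rewrite rmorph1 rmorphD !rmorphM /= qz0 fz !mulr0 add0r eq_sym oner_eq0.
  rewrite coprimep_def => /irr/(_ (dvdp_gcdl _ _)) gcd_f.
  have /dvdpP[c ->] : f %| q by rewrite -(eqp_dvdl _ gcd_f) dvdp_gcdr.
  by rewrite rmorphM /= fa0 mulr0.
pose rho l := horner_alg a (sval (onto l)).
have rhoE q : rho (horner_alg z q) = horner_alg a q.
  apply/eqP; rewrite -subr_eq0 -rmorphB; apply/eqP/ker.
  by rewrite rmorphB /= (eqP (svalP (onto _))) subrr.
have ontoE l : exists q, l = horner_alg z q.
  by exists (sval (onto l)); rewrite (eqP (svalP (onto l))).
have rhoL : linear rho.
  move=> k u v; have [[p ->] [q ->]] := (ontoE u, ontoE v).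
  have <- : horner_alg z (k *: p + q) = k *: horner_alg z p + horner_alg z q.
    exact: horner_alg_linear.
  by rewrite !rhoE horner_alg_linear.
have rhoM : monoid_morphism rho.
  split; first by rewrite -(rmorph1 (horner_alg z)) rhoE rmorph1.
  move=> u v; have [[p ->] [q ->]] := (ontoE u, ontoE v).
  by rewrite -rmorphM !rhoE rmorphM.
pose mL := GRing.isLinear.Build K L R _ rho rhoL.
pose mM := GRing.isMonoidMorphism.Build L R rho rhoM.
pose F : {lrmorphism L -> R} := HB.pack rho mL mM.
exists F => [q | l]; first by exists (horner_alg z q); apply: rhoE.
by exists (sval (onto l)).
Qed.

Lemma field_alg_simple (K : fieldType) (R : falgType K) :
  field_alg R -> simple_alg R.
Proof.
move=> [_ fR] I /two_sided_idealP idI.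
have [-> | nzI] := eqVneq I 0%VS; [by left | right].
apply/eqP; rewrite eqEsubv subvf; apply/subvP=> a _.
have nzv : vpick I != 0 by rewrite vpick0.
have [Ia _] := idI (a * (vpick I)^-1) _ (memv_pick I).
by rewrite divrK ?fR // in Ia.
Qed.

Lemma field_alg_of_root (K : fieldType) (R : falgType K) (f : {poly K}) (a : R) :
  irreducible_poly f -> horner_alg a f = 0 ->
  (forall r, exists q : {poly K}, r = horner_alg a q) -> field_alg R.
Proof.
move=> /irredp_lift[L lift] /lift[rho rhoP _] gen.
have onto r : exists l, r = rho l.
  by have [q ->] := gen r; have [l <-] := rhoP q; exists l.
split=> [u v | u nz_u].
  by have [[k ->] [l ->]] := (onto u, onto v); rewrite -!rmorphM mulrC.
have [l def_u] := onto u; have nz_l : l != 0.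
  by apply: contraNneq nz_u => l0; rewrite def_u l0 rmorph0.
apply/unitrP; exists (rho l^-1).
by rewrite def_u -!rmorphM mulVf ?mulfV // rmorph1.
Qed.

Section MatrixUnits.

Variables (K : fieldType) (R : falgType K) (L : fieldExtType K).
Variables (rho : {lrmorphism L -> R}) (n : nat) (e : 'I_n.+1 -> 'I_n.+1 -> R).
Hypothesis eM : forall i j k l, e i j * e k l = if j == k then e i l else 0.
Hypothesis e1 : \sum_i e i i = 1.
Hypothesis cen : forall l r, rho l * r = r * rho l.

Definition of_matrix (M : 'M[L]_n.+1) : R := \sum_i \sum_j rho (M i j) * e i j.

Lemma of_matrix_linear (k : K) (M N : 'M[L]_n.+1) :
  of_matrix (k%:A *: M + N) = k *: of_matrix M + of_matrix N.
Proof.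
rewrite /of_matrix scaler_sumr -big_split; apply: eq_bigr => i _ /=.
rewrite scaler_sumr -big_split; apply: eq_bigr => j _ /=.
by rewrite !mxE mulr_algl linearP mulrDl scalerAl.
Qed.

Lemma of_matrixM (M N : 'M[L]_n.+1) :
  of_matrix (M * N) = of_matrix M * of_matrix N.
Proof.
rewrite /of_matrix mulr_suml; apply: eq_bigr => i _ /=.
rewrite mulr_suml [RHS](eq_bigr (fun k => \sum_j rho (M i k * N k j) * e i j)).
  rewrite exchange_big; apply: eq_bigr => j _ /=.
  by rewrite mxE rmorph_sum mulr_suml.
move=> k _; rewrite mulr_sumr (bigD1 k) //= [X in _ + X]big1 ?addr0.
  rewrite mulr_sumr; apply: eq_bigr => j _.
  by rewrite rmorphM mulrA -(mulrA (rho _)) -(cen (N k j) (e i k)) !mulrA -mulrA eM eqxx.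
move=> k' /negPf nk; rewrite mulr_sumr big1 // => j _.
by rewrite mulrA -(mulrA (rho _)) -(cen _ (e i k)) mulrA -mulrA eM eq_sym nk mulr0.
Qed.

Lemma of_matrix1 : of_matrix 1 = 1.
Proof.
rewrite -e1; apply: eq_bigr => i _; rewrite (bigD1 i) //= [X in _ + X]big1 ?addr0.
  by rewrite mxE eqxx rmorph1 mul1r.
by move=> j /negPf nj; rewrite mxE eq_sym nj rmorph0 mul0r.
Qed.

(** Multiplying by [e k i] and [e j k] keeps only the entry (i, j) and moves it to (k, k); summing
    over k makes it scalar. Injectivity, simplicity and the computation of the centre rest on this
    formula. *)
Lemma of_matrix_coef (M : 'M[L]_n.+1) i j :
  \sum_k e k i * of_matrix M * e j k = rho (M i j).
Proof.
rewrite -[RHS]mulr1 -e1 mulr_sumr; apply: eq_bigr => k _.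
rewrite /of_matrix mulr_sumr mulr_suml (bigD1 i) //= [X in _ + X]big1 ?addr0.
  rewrite mulr_sumr mulr_suml (bigD1 j) //= [X in _ + X]big1 ?addr0.
    by rewrite mulrA -cen -!mulrA !eM !eqxx eM eqxx.
  by move=> l /negPf nl; rewrite -!mulrA eM nl !mulr0.
move=> l nl; rewrite mulr_sumr mulr_suml big1 // => l' _.
by rewrite mulrA -cen -!mulrA (mulrA (e k i)) eM eq_sym (negPf nl) mul0r mulr0.
Qed.

Lemma of_matrix_inj : injective of_matrix.
Proof.
move=> M N eqMN; apply/matrixP=> i j; have := of_matrix_coef M i j.
by rewrite eqMN of_matrix_coef => /fmorph_inj.
Qed.

Hypothesis onto : forall r, exists M, r = of_matrix M.

Lemma of_matrix_iso : exists f : {rmorphism 'M[L]_n.+1 -> R},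
  bijective f /\ forall (k : K) (M : 'M[L]_n.+1), f (k%:A *: M) = k *: f M.
Proof.
have f0 : of_matrix 0 = 0.
  by rewrite /of_matrix big1 // => i _; rewrite big1 // => j _; rewrite mxE rmorph0 mul0r.
have fB : additive of_matrix.
  by move=> M N; have := of_matrix_linear (-1) N M; rewrite !scaleN1r ![- _ + _]addrC.
pose mA := GRing.isZmodMorphism.Build 'M[L]_n.+1 R of_matrix fB.
pose mM := GRing.isMonoidMorphism.Build 'M[L]_n.+1 R of_matrix (of_matrix1, of_matrixM).
pose F : {rmorphism 'M[L]_n.+1 -> R} := HB.pack of_matrix mA mM.
exists F; split; last first.
  by move=> k M /=; rewrite -[X in of_matrix X]addr0 of_matrix_linear f0 addr0.
have inv r : {M | of_matrix M == r} by apply: sigW; have [M ->] := onto r; exists M.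
exists (fun r => sval (inv r)) => [M|r] /=; last exact/eqP/(svalP (inv r)).
by apply: of_matrix_inj; apply/eqP/(svalP (inv _)).
Qed.

Lemma of_matrix_simple : simple_alg R.
Proof.
move=> I /two_sided_idealP idI.
have [-> | nzI] := eqVneq I 0%VS; [by left | right].
apply/eqP; rewrite eqEsubv subvf; apply/subvP=> a _.
have [M defM] := onto (vpick I); have nzM : M != 0.
  apply: contraNneq nzI => M0; rewrite -vpick0 defM M0 /of_matrix big1 // => i _.
  by rewrite big1 // => j _; rewrite mxE rmorph0 mul0r.
have /existsP[[i j] /= nzMij] : [exists p : 'I_n.+1 * 'I_n.+1, M p.1 p.2 != 0].
  apply: contraR nzM => /existsPn M0; apply/eqP/matrixP=> i j.
  by apply/eqP; move/(_ (i, j)): (M0); rewrite negbK mxE.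
have Irho : rho (M i j) \in I.
  rewrite -of_matrix_coef memv_suml // => k _; rewrite -defM.
  by case: (idI (e j k) (e k i * vpick I)) => //; case: (idI (e k i) _ (memv_pick I)).
have [] := idI (a * rho (M i j)^-1) _ Irho.
by rewrite -mulrA -rmorphM mulVf // rmorph1 mulr1.
Qed.

(** The centre is the image of [rho]: a central element commutes past the matrix units, so
    [of_matrix_coef] identifies it with [rho] of its entry (0, 0). *)
Lemma of_matrix_dim : \dim {:R} = (n.+1 ^ 2 * \dim 'Z({:R})%VS)%N.
Proof.
have rhoE l : linfun rho l = rho l by rewrite lfunE.
have <- : limg (linfun rho) = 'Z({:R})%VS.
  apply/vspaceP=> r; apply/memv_imgP/idP=> [[l _ ->] | Zr].
    by rewrite rhoE memv_cap memvf; apply/centvP=> a _; rewrite cen.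
  have [M defr] := onto r; exists (M ord0 ord0); rewrite ?memvf // rhoE.
  move: Zr; rewrite memv_cap => /andP[_ /centvP Zr].
  rewrite -of_matrix_coef -defr -[LHS]mulr1 -e1 mulr_sumr; apply: eq_bigr => k _.
  by rewrite -Zr ?memvf // -mulrA eM eqxx.
rewrite limg_dim_eq; last first.
  apply/eqP; rewrite capfv; apply/lker0P=> x y; rewrite !rhoE; exact: fmorph_inj.
(* Functions on pairs of indices stand in for matrices here: they form a vector space over [K], not
   only over [L]. *)
pose phi (v : {ffun 'I_n.+1 * 'I_n.+1 -> L}) := of_matrix (\matrix_(i, j) v (i, j)).
have phiL : linear phi.
  move=> k u v; rewrite /phi -of_matrix_linear; congr of_matrix.
  by apply/matrixP=> i j; rewrite !mxE !ffunE mulr_algl.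
pose mL := GRing.isLinear.Build K _ R _ phi phiL.
pose Phi : {linear {ffun 'I_n.+1 * 'I_n.+1 -> L} -> R} := HB.pack phi mL.
have PhiE v : linfun Phi v = phi v by rewrite lfunE.
have <- : limg (linfun Phi) = {:R}%VS.
  apply/eqP; rewrite eqEsubv subvf; apply/subvP=> r _; have [M ->] := onto r.
  apply/memv_imgP; exists [ffun p => M p.1 p.2]; rewrite ?memvf // PhiE.
  by congr of_matrix; apply/matrixP=> i j; rewrite !mxE ffunE.
rewrite limg_dim_eq; last first.
  apply/eqP; rewrite capfv; apply/lker0P=> u v; rewrite !PhiE => /of_matrix_inj/matrixP uv.
  by apply/ffunP=> -[i j]; have := uv i j; rewrite !mxE.
rewrite !dimvf; transitivity (#|{: 'I_n.+1 * 'I_n.+1}| * dim L)%N => //.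
by rewrite card_prod card_ord mulnn.
Qed.

End MatrixUnits.

Lemma horner_alg_central (K : fieldType) (R : algType K) (a : R) :
  (forall r, a * r = r * a) ->
  forall (q : {poly K}) r, horner_alg a q * r = r * horner_alg a q.
Proof.
move=> cen q r; elim/poly_ind: q => [|q c IHq]; first by rewrite rmorph0 mul0r mulr0.
rewrite rmorphD rmorphM /= horner_algX horner_algC mulrDl mulrDr.
by rewrite mulr_algl mulr_algr -[_ * a * r]mulrA cen mulrA IHq -mulrA.
Qed.

Section Quaternion.

Variables (K : fieldType) (R : falgType K) (f : {poly K}) (a x y : R).
Hypotheses (nz2 : 2%:R != 0 :> K) (irr_f : irreducible_poly f).
Hypotheses (fa0 : horner_alg a f = 0) (cen_a : forall r, a * r = r * a).
Hypotheses (xx : x * x = 1) (yy : y * y = 1) (xy : x * y = - (y * x)).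
Hypothesis gen : forall r, exists q : {poly K} * {poly K} * ({poly K} * {poly K}),
  r = horner_alg a q.1.1 + horner_alg a q.1.2 * x
      + (horner_alg a q.2.1 + horner_alg a q.2.2 * x) * y.

Let u : R := 2%:R^-1 *: (1 + x).
Let e (i j : 'I_2) : R := y ^+ i * u * y ^+ j.

Let uE : u + u = 1 + x.
Proof. by rewrite -mulr2n -scaler_nat scalerA mulfV // scale1r. Qed.

(** As [y] anticommutes with [x], conjugation by [y] exchanges the idempotents [u] and 1 - u. So the
    [e i j] multiply as 2 by 2 matrix units, over the field that [irredp_lift] maps into the
    centre. *)
Lemma quaternion_of_gens : quaternion_alg R /\ matrix2_alg R.
Proof.
have hh : 2%:R^-1 *: (2%:R : R) = 1.
  by rewrite -scaler_nat scalerA mulVf // scale1r.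
have uu : u * u = u.
  rewrite /u -scalerAl -scalerAr; congr (_ *: _).
  rewrite mulrDl mul1r mulrDr mulr1 xx [x + 1]addrC -mulr2n -scaler_nat.
  by rewrite scalerA mulVf // scale1r.
have yuy : y * u * y = 1 - u.
  rewrite /u -scalerAr -scalerAl mulrDr mulrDl mulr1 yy -mulrA xy mulrN mulrA yy mul1r.
  apply/eqP; rewrite eq_sym subr_eq -scalerDr addrACA addNr addr0.
  by rewrite -[1 + 1]/(2%:R : R) hh.
have uyu : u * y * u = 0.
  by rewrite -[LHS]mul1r -yy -!mulrA (mulrA y u) (mulrA (y * u)) yuy
             mulrBl mul1r uu subrr mulr0.
have yu : y * u = (1 - u) * y by rewrite -yuy -[RHS]mulrA yy mulr1.
have xE : x = u - (1 - u) by rewrite opprB addrA uE addrC addKr.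
have eM i j k l : e i j * e k l = if j == k then e i l else 0.
  rewrite /e -!mulrA (mulrA (y ^+ j)) -exprD.
  case: (altP (j =P k)) => [<- | njk].
    rewrite addnn -mul2n exprM expr2 yy expr1n mul1r.
    by rewrite (mulrA u) uu.
  have -> : (j + k = 1)%N.
    by case: j k njk => [[|[]] // ?] [[|[]] // ?].
  by rewrite expr1 (mulrA u) (mulrA (u * y)) uyu mul0r mulr0.
have e1 : \sum_i e i i = 1.
  by rewrite !big_ord_recl big_ord0 /e /= !expr0 !expr1 mul1r mulr1 addr0 yuy addrC subrK.
have [L lift] := irredp_lift irr_f; have [rho rhoP rhoQ] := lift R a fa0.
have cen l r : rho l * r = r * rho l.
  by have [q ->] := rhoQ l; apply: horner_alg_central.
have onto r : exists M, r = of_matrix rho e M.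
  have [[[q0 q1] [q2 q3]] /= ->] := gen r.
  have [[l0 <-] [l1 <-]] := (rhoP q0, rhoP q1).
  have [[l2 <-] [l3 <-]] := (rhoP q2, rhoP q3).
  (* Here x = e 0 0 - e 1 1, and right multiplication by [y] turns e 0 0 into e 0 1 and e 1 1 into e
     1 0, which gives the entries. *)
  exists (\matrix_(i, j) if i == 0 then (if j == 0 then l0 + l1 else l2 + l3)
                         else (if j == 0 then l2 - l3 else l0 - l1)).
  rewrite /of_matrix !big_ord_recl !big_ord0 !addr0 !mxE /=.
  rewrite /e /= !expr0 !expr1 !mulr1 !mul1r yuy yu !rmorphD !rmorphN /=.
  have comb p1 p2 : p1 + p2 * x = (p1 + p2) * u + (p1 - p2) * (1 - u).
    rewrite [x]xE mulrDl (mulrDl p1 (- p2)) mulNr addrACA -mulrDr subrKC mulr1.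
    by rewrite -mulrBr.
  rewrite !comb [(_ + _ * (1 - u)) * y]mulrDl !mulrA -!addrA; congr (_ + _).
  by rewrite [LHS]addrC -addrA.
split; last by have [g [bij_g g_lin]] := of_matrix_iso eM e1 cen onto; exists L, g.
split; first exact: (of_matrix_simple eM e1 cen onto).
exact: (of_matrix_dim eM e1 cen onto).
Qed.

End Quaternion.

(** * Orthogonal idempotents modulo a product of coprime polynomials *)

Section ChineseIdempotents.

Variables (K : fieldType) (I : finType) (f : I -> {poly K}).
Hypothesis size_f : forall i, (1 < size (f i))%N.
Hypothesis co_f : forall i j, i != j -> coprimep (f i) (f j).

Lemma dvdp_coprime_prod (p : {poly K}) :
  (forall i, f i %| p) -> \prod_i f i %| p.
Proof.
move=> dvd_p; rewrite -big_enum; have := enum_uniq I; elim: (enum I) => [|i r IHr] /=.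
  by rewrite big_nil dvd1p.
case/andP=> i'r /IHr r_p; rewrite big_cons Gauss_dvdp ?dvd_p //.
rewrite big_seq; elim/big_ind: _ => [|q1 q2 co1 co2|j rj]; first exact: coprimep1.
  by rewrite coprimepMr co1.
by apply: co_f; apply: contraNneq i'r => ->.
Qed.

(** With [h i] the product of the other factors, a Bezout relation between [f i] and [h i] yields a
    multiple of [h i] that is 1 modulo [f i]. The last clause holds because [f i] is not
    constant. *)
Lemma chinese_idempotents : exists eps : I -> {poly K},
  [/\ forall i j, i != j -> \prod_i f i %| eps i * eps j,
      \prod_i f i %| \sum_i eps i - 1,
      forall i, \prod_i f i %| eps i * f i
    & forall i, ~~ (\prod_i f i %| eps i)].
Proof.
pose h i := \prod_(j | j != i) f j.
have prodE i : \prod_i f i = f i * h i by rewrite (bigD1 i).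
have co_h i : coprimep (f i) (h i).
  rewrite /h; elim/big_ind: _ => [|q1 q2 co1 co2|j ji]; first exact: coprimep1.
    by rewrite coprimepMr co1.
  by apply: co_f; rewrite eq_sym.
have dvd_h i j : j != i -> f j %| h i by move=> ji; rewrite /h (bigD1 j) //= dvdp_mulr.
have /fin_all_exists[u uP] i : exists u : {poly K} * {poly K}, u.1 * f i + u.2 * h i = 1.
  exact/Bezout_eq1_coprimepP.
pose eps i := (u i).2 * h i.
have eps_i i : f i %| eps i - 1.
  by rewrite -(uP i) opprD addrCA subrr addr0 -mulNr dvdp_mull.
have eps_j i j : j != i -> f j %| eps i by move=> ji; rewrite dvdp_mull ?dvd_h.
exists eps; split=> [i j ij||i|i].
- apply: dvdp_coprime_prod => k; have [-> | ki] := eqVneq k i.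
    by rewrite dvdp_mull ?eps_j.
  by rewrite dvdp_mulr ?eps_j.
- apply: dvdp_coprime_prod => k; rewrite (bigD1 k) //= addrAC dvdp_add ?eps_i //.
  by elim/big_ind: _ => [||i ki]; [exact: dvdp0 | exact: dvdp_add |
    rewrite eps_j // eq_sym].
- by rewrite (prodE i) mulrC dvdp_mul // dvdp_mull.
apply/negP=> dvd_eps; have := size_f i; rewrite ltnNge => /negP[].
have : f i %| 1.
  rewrite -[1](subKr (eps i)) dvdp_sub ?eps_i //.
  by apply: dvdp_trans dvd_eps; rewrite (prodE i) dvdp_mulr.
by rewrite dvdp1 => /eqP->.
Qed.

End ChineseIdempotents.

(** * The group of type D_1 *)

(* The triple (i, a, b) stands for t^i x^a y^b. *)
Definition d1_model (m : nat) := ('Z_(2 ^ m.+1) * bool * bool)%type.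

Section Model.

Variable m : nat.
Local Notation T := (d1_model m).
HB.instance Definition _ := Finite.on T.

Let c : 'Z_(2 ^ m.+1) := (2 ^ m)%:R.

Let n_gt1 : (1 < 2 ^ m.+1)%N.
Proof. by rewrite -{1}(expn0 2) ltn_exp2l. Qed.

Let cc : c + c = 0.
Proof. by rewrite /c -natrD addnn -mul2n -expnS pchar_Zp. Qed.

(** Here [m] is one less than the exponent in the theorem, so [c] is the exponent of the central
    involution. Moving y^b past x^a contributes [c] exactly when a = b = 1. *)
Definition d1_mul (u v : T) : T :=
  (u.1.1 + v.1.1 + c *+ (u.2 && v.1.2), u.1.2 (+) v.1.2, u.2 (+) v.2).
Definition d1_one : T := (0, false, false).
Definition d1_inv (u : T) : T := (- u.1.1 + c *+ (u.2 && u.1.2), u.1.2, u.2).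

Fact d1_mulA : associative d1_mul.
Proof.
move=> [[i a] b] [[j a'] b'] [[k a''] b''].
rewrite /d1_mul /= !addbA; congr (_, _, _).
have cE : c *+ (b && a') + c *+ ((b (+) b') && a'')
        = c *+ (b' && a'') + c *+ (b && (a' (+) a'')).
  by case: b b' a' a'' => [] [] [] []; rewrite /= ?mulr0n ?mulr1n ?addr0 ?add0r ?cc.
by rewrite [in RHS](addrAC (i + j)) -[RHS]addrA cE !addrA.
Qed.

Fact d1_mul1 : left_id d1_one d1_mul.
Proof. by move=> [[i a] b]; rewrite /d1_mul /= add0r addr0. Qed.

Fact d1_mulV : left_inverse d1_one d1_inv d1_mul.
Proof.
move=> [[i a] b]; rewrite /d1_mul /= !addbb (addrAC (- i)) addNr add0r.
by case: (b && a); rewrite /= ?addr0 ?cc.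
Qed.

HB.instance Definition _ :=
  Finite_isGroup.Build T d1_mulA d1_mul1 d1_mulV.

Let t : T := (1, false, false).
Let x : T := (0, true, false).
Let y : T := (0, false, true).

Let tX k : (t ^+ k)%g = (k%:R, false, false) :> T.
Proof.
elim: k => // k IHk; rewrite expgSr IHk /mulg /= /d1_mul /=.
by rewrite addr0 -mulrSr.
Qed.

(** Serves as a lower bound: the model is an image of the presented group, so the relations cannot
    collapse that group below order 4 * 2^(m+1). *)
Lemma d1_model_hom :
  ([set: T] \homg Grp (t : x : y :
     t ^+ (2 ^ m.+1), x ^+ 2, y ^+ 2, [~ t, x], [~ t, y],
     [~ x, y] = t ^+ (2 ^ m)))%g.
Proof.
apply/existsP; exists ((t, x), y); rewrite /= !xpair_eqE.
have tr (i j k : T) : (i * k = k * i * j)%g -> [~ i, k]%g = j.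
  by move=> e; rewrite commgEl /conjg mulgA -invMg e mulKg.
have -> : (<[t]> <*> <[x]> <*> <[y]>)%g = [set: T].
  apply/eqP; rewrite eqEsubset subsetT; apply/subsetP=> -[[i a] b] _.
  have -> : (i, a, b) = (t ^+ i * x ^+ a * y ^+ b)%g.
    rewrite tX natr_Zp; case: a b => [] []; rewrite /mulg /= /d1_mul /= ?addr0 //.
  rewrite !groupM ?groupX //; last by rewrite (subsetP (joing_subr _ _)) ?cycle_id.
    by rewrite (subsetP (joing_subl _ _)) // (subsetP (joing_subl _ _)) ?cycle_id.
  by rewrite (subsetP (joing_subl _ _)) // (subsetP (joing_subr _ _)) ?cycle_id.
rewrite !tX pchar_Zp // eqxx /=.
rewrite !mulr0n oppr0 !addr0 add0r addNr !eqxx /=; apply/eqP/tr.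
rewrite /mulg /= /d1_mul /=.
by rewrite !mulr0n !mulr1n !addr0 !add0r cc.
Qed.


Lemma card_d1_model : #|{: d1_model m}| = (2 ^ m.+1 * 4)%N.
Proof. by rewrite !card_prod card_bool card_ord Zp_cast // -mulnA. Qed.

End Model.

(** The relations bring every element to the form t^i x^a y^b, since [x] commutes with [t] and [y]
    normalizes the subgroup generated by [t] and [x]; this bounds the order from above. The model
    bounds it from below, so the form is unique. *)
Lemma d1_normal_form (m : nat) (gT : finGroupType) :
  ([set: gT] \isog Grp (t : x : y :
     t ^+ (2 ^ m.+1), x ^+ 2, y ^+ 2, [~ t, x], [~ t, y],
     [~ x, y] = t ^+ (2 ^ m)))%g ->
  exists t x y : gT,
    [/\ [/\ (t ^+ (2 ^ m.+1) = 1)%g, (x * x = 1)%g & (y * y = 1)%g],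
        [/\ commute t x, commute t y & (x * y = y * x * t ^+ (2 ^ m))%g]
      & bijective (fun p : 'I_(2 ^ m.+1) * bool * bool =>
          (t ^+ p.1.1 * x ^+ p.1.2 * y ^+ p.2)%g)].
Proof.
move=> hG; have /existsP[[[t x] y] /=] := isoGrp_hom hG.
rewrite !xpair_eqE => /andP[/eqP genG].
case/and5P=> /eqP t1 /eqP x2 /eqP y2 /commgP ctx /andP[/commgP cty /eqP cxy].
rewrite expgS expg1 in x2; rewrite expgS expg1 in y2.
have xyE : (x * y = y * x * t ^+ (2 ^ m))%g.
  by rewrite -cxy commgEl /conjg !mulgA mulgK mulgV mul1g.
exists t, x, y; split=> //.
pose phi (p : 'I_(2 ^ m.+1) * bool * bool) := (t ^+ p.1.1 * x ^+ p.1.2 * y ^+ p.2)%g.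
have onto g : exists p, g = phi p.
  have : g \in (<[t]> <*> <[x]> <*> <[y]>)%g by rewrite genG inE.
  have half (u g' : gT) : (u * u = 1)%g -> g' \in <[u]>%g ->
      exists b : bool, g' = (u ^+ b)%g.
    move=> uu /cyclePmin[i lti ->].
    have : (i < 2)%N by rewrite (leq_trans lti) // dvdn_leq // order_dvdn expgS expg1 uu.
    by case: i {lti} => [|[|//]] _; [exists false | exists true].
  have cent_tx : (<[x]> \subset 'C(<[t]>))%g.
    rewrite cycle_subG; apply/centP=> _ /cycleP[i ->].
    exact/commuteX/commute_sym.
  have norm_y : (<[y]> \subset 'N(<[t]> <*> <[x]>))%g.
    have Ht : (t \in <[t]> <*> <[x]>)%g by rewrite (subsetP (joing_subl _ _)) ?cycle_id.
    have Hx : (x \in <[t]> <*> <[x]>)%g by rewrite (subsetP (joing_subr _ _)) ?cycle_id.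
    rewrite cycle_subG inE conjYg -!cycleJ join_subG !cycle_subG.
    by rewrite /conjg cty mulKg Ht xyE -mulgA mulKg groupM ?groupX.
  rewrite (norm_joinEr norm_y) /= (cent_joinEr cent_tx).
  case/mulsgP=> _ v /mulsgP[_ u /cyclePmin[i lti ->] xu ->] yv ->.
  have [a ->] := half _ _ x2 xu; have [b ->] := half _ _ y2 yv.
  have lti' : (i < 2 ^ m.+1)%N.
    by rewrite (leq_trans lti) // dvdn_leq ?expn_gt0 // order_dvdn t1.
  by exists (Ordinal lti', a, b).
have leG : (#|{: 'I_(2 ^ m.+1) * bool * bool}| <= #|gT|)%N.
  rewrite !card_prod card_bool card_ord -mulnA -[X in (X <= _)%N]card_d1_model.
  rewrite -cardsT -[X in (_ <= X)%N]cardsT leq_homg //.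
  by rewrite hG d1_model_hom.
have codE : codom phi =i gT.
  by move=> g; have [p ->] := onto g; rewrite codom_f inE.
have inj : injective phi.
  apply/injectiveP; apply/card_uniqP.
  rewrite size_map -cardE (eq_card codE).
  by apply/eqP; rewrite eqn_leq leG andbT -(eq_card codE); apply: leq_image_card.
have inv g : {p | phi p == g} by apply: sigW; have [p ->] := onto g; exists p.
exists (fun g => sval (inv g)) => [p | g]; last exact/eqP/(svalP (inv g)).
by apply: inj; apply/eqP/(svalP (inv _)).
Qed.

(** * Decomposition of an algebra of type D_1 *)

Lemma horner_alg_morph (K : fieldType) (A B : algType K)
    (g : {lrmorphism A -> B}) (a : A) (q : {poly K}) :
  g (horner_alg a q) = horner_alg (g a) q.
Proof.
elim/poly_ind: q => [|q c IHq]; first by rewrite !rmorph0.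
rewrite !rmorphD !rmorphM /= !horner_algX !horner_algC IHq.
by rewrite linearZ /= rmorph1.
Qed.

Definition factorization (K : fieldType) (p : {poly K}) (s : seq {poly K}) : Prop :=
  p %= \prod_(q <- s) q /\ (forall q, q \in s -> irreducible_poly q).

Section HalfIdempotents.

Variables (K : fieldType) (A : algType K) (u : A).
Hypotheses (nz2 : 2%:R != 0 :> K) (uu : u * u = 1).

(** The projection onto the part where the involution [u] acts as (-1)^b. *)
Definition half (b : bool) : A := 2%:R^-1 *: (1 + (-1) ^+ b * u).

Lemma sum_half : \sum_b half b = 1.
Proof.
rewrite big_bool /half /= expr0 expr1 mul1r mulN1r -scalerDr addrACA addNr addr0.
by rewrite -[1 + 1]mulr2n -scaler_nat scalerA mulVf // scale1r.
Qed.

Lemma half_absorb b : half b * u = (-1) ^+ b * half b.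
Proof.
rewrite /half -scalerAl -scalerAr; congr (_ *: _).
by rewrite mulrDl mulrDr mul1r mulr1 -mulrA uu mulr1 mulrA -signr_addb addbb mul1r addrC.
Qed.

Lemma half_orth b c : b != c -> half b * half c = 0.
Proof.
move=> bc; rewrite {2}/half -scalerAr mulrDr mulr1 mulrA commr_sign.
rewrite -mulrA half_absorb mulrA -signr_addb.
have -> : c (+) b by case: b c bc => [] [].
by rewrite expr1 mulN1r subrr scaler0.
Qed.

(** The factor [e] is there because [x] and [y] will commute only on the components where t^n acts
    as 1, that is, after multiplication by suitable idempotents. *)
Lemma half_comm (v e : A) b :
  e * (u * v) = e * (v * u) -> e * (half b * v) = e * (v * half b).
Proof.
move=> euv; rewrite /half -scalerAl -!scalerAr; congr (_ *: _).
rewrite mulrDl !mulrDr mul1r mulr1; congr (_ + _).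
have aux w : e * ((-1) ^+ b * w) = (-1) ^+ b * (e * w).
  by rewrite mulrA commr_sign -mulrA.
by rewrite -mulrA (mulrA v) commr_sign -mulrA !aux euv.
Qed.

End HalfIdempotents.

Section Decomposition.

Variables (K : fieldType) (A : falgType K) (n : nat) (t x y : A).
Hypotheses (nz2 : 2%:R != 0 :> K) (nz_n : n%:R != 0 :> K).
Hypotheses (cen_t : forall a, t * a = a * t) (xx : x * x = 1) (yy : y * y = 1).
Hypotheses (xy : x * y = y * x * t ^+ n) (t1 : t ^+ (n * 2) = 1).
Hypothesis gen : forall r, exists q : {poly K} * {poly K} * ({poly K} * {poly K}),
  r = horner_alg t q.1.1 + horner_alg t q.1.2 * x
      + (horner_alg t q.2.1 + horner_alg t q.2.2 * x) * y.
Hypothesis indep : forall q1 q2 q3 q4 : {poly K},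
  horner_alg t q1 + horner_alg t q2 * x + (horner_alg t q3 + horner_alg t q4 * x) * y = 0 ->
  'X^(n * 2) - 1 %| q1.

Variables (Ps Qs : seq {poly K}).
Hypotheses (facP : factorization ('X^n - 1) Ps) (facQ : factorization ('X^n + 1) Qs).

Local Notation "q .[t]" := (horner_alg t q) (at level 2, left associativity, format "q .[t]").
Local Notation pI := ('I_(size Ps) + 'I_(size Qs))%type.

Let f (i : pI) : {poly K} := match i with inl j => Ps`_j | inr j => Qs`_j end.
Let N : {poly K} := \prod_i f i.

Let NE : N %= 'X^(n * 2) - 1.
Proof.
have -> : 'X^(n * 2) - 1 = ('X^n - 1) * ('X^n + 1) :> {poly K}.
  by rewrite exprM -subr_sqr_1.
have [/eqp_mulr eP _] := facP; have [/eqp_mull eQ _] := facQ.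
rewrite eqp_sym (eqp_trans (eP _)) // (eqp_trans (eQ _)) //.
have prodE (s : seq {poly K}) : \prod_(q <- s) q = \prod_(i < size s) s`_i.
  by rewrite (big_nth 0) big_mkord.
by rewrite !prodE /N big_sumType eqpxx.
Qed.

Let irr_f i : irreducible_poly (f i).
Proof.
by case: i => i; [have [_] := facP | have [_] := facQ]; apply; apply: mem_nth.
Qed.

(** X^(n * 2) - 1 is separable because 2 and n are nonzero in [K], and two factors of a separable
    product have no nonconstant common divisor. *)
Let co_f i j : i != j -> coprimep (f i) (f j).
Proof.
move=> ij; apply: (@separable_coprime _ N).
  rewrite (eqp_separable NE) separable_Xn_sub_1 //.
  by rewrite natrM mulf_neq0.
by rewrite /N (bigD1 i) //= (bigD1 j) 1?eq_sym //= mulrA dvdp_mulr.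
Qed.

Let NtE (q : {poly K}) : N %| q -> q.[t] = 0.
Proof.
rewrite (eqp_dvdl _ NE) => /dvdpP[r ->].
rewrite rmorphM rmorphB /= rmorphXn /= horner_algX t1 rmorph1 subrr.
by rewrite mulr0.
Qed.

Let ht q a : q.[t] * a = a * q.[t].
Proof. exact: horner_alg_central. Qed.

Let cen_of a : a * x = x * a -> a * y = y * a -> forall b, b * a = a * b.
Proof.
move=> ax ay b; have [[[q1 q2] [q3 q4]] /= ->] := gen b.
have aux q q' : (q.[t] + q'.[t] * x) * a = a * (q.[t] + q'.[t] * x).
  by rewrite mulrDl mulrDr ht -mulrA -ax !mulrA ht.
by rewrite mulrDl mulrDr aux -mulrA -ay !mulrA aux.
Qed.

(** As [f (inl j)] divides X^n - 1, the polynomial [N] divides e * (X^n - 1). So t^n acts as 1 here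
    and, by the same argument, as -1 on the components that come from X^n + 1. *)
Let tn j (e : {poly K}) : N %| e * f (inl j) -> e.[t] * t ^+ n = e.[t].
Proof.
move=> dvd_e; have [c cE] : exists c, 'X^n - 1 = c * f (inl j).
  apply/dvdpP; case: facP => /(eqp_dvdr _)-> _.
  by rewrite (big_nth 0) big_mkord (bigD1 j) //= dvdp_mulr.
have /NtE : N %| e * ('X^n - 1) by rewrite cE mulrCA dvdp_mull.
rewrite rmorphM rmorphB /= rmorphXn /= horner_algX rmorph1 mulrBr mulr1.
by move/subr0_eq.
Qed.

Let tnN j (e : {poly K}) : N %| e * f (inr j) -> e.[t] * t ^+ n = - e.[t].
Proof.
move=> dvd_e; have [c cE] : exists c, 'X^n + 1 = c * f (inr j).
  apply/dvdpP; case: facQ => /(eqp_dvdr _)-> _.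
  by rewrite (big_nth 0) big_mkord (bigD1 j) //= dvdp_mulr.
have /NtE : N %| e * ('X^n + 1) by rewrite cE mulrCA dvdp_mull.
rewrite rmorphM rmorphD /= rmorphXn /= horner_algX rmorph1 mulrDr mulr1.
by move/eqP; rewrite addr_eq0 => /eqP.
Qed.

(** On this block [x] and [y] become signs, so the block is generated by the image of [t], a root of
    [f i]. *)
Lemma block_field_alg (e : A) (i : pI) (b c : bool) : central_idem e ->
  e * (f i).[t] = 0 -> e * x = (-1) ^+ b * e -> e * y = (-1) ^+ c * e ->
  field_alg (subvs_of (block e)).
Proof.
move=> ide ef ex ey; have [g gE] := block_proj ide.
have eqg u v : e * u = e * v -> g u = g v.
  by move=> euv; apply: val_inj; rewrite /= !gE.
have gx : g x = (-1) ^+ b by rewrite -(rmorph_sign g); apply: eqg; rewrite ex commr_sign.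
have gy : g y = (-1) ^+ c by rewrite -(rmorph_sign g); apply: eqg; rewrite ey commr_sign.
apply: (@field_alg_of_root _ _ (f i) (g t)) => // [|r].
  by rewrite -horner_alg_morph -(rmorph0 g); apply: eqg; rewrite ef mulr0.
have [[[q1 q2] [q3 q4]] /= rE] := gen (vsval r).
exists (q1 + q2 * (-1) ^+ b + (q3 + q4 * (-1) ^+ b) * (-1) ^+ c).
have -> : r = g (vsval r).
  apply: val_inj; rewrite /= gE; apply/esym/eqP; rewrite -memv_block //.
  exact: subvsP.
rewrite rE -!horner_alg_morph !rmorphD /= !rmorphM /= !rmorphD /= !rmorphM /= !rmorph_sign.
by rewrite gx gy.
Qed.

(** With t^n acting as -1, the relation between [x] and [y] becomes anticommutation on the block. *)
Lemma block_quaternion (e : A) (i : pI) : central_idem e ->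
  e * (f i).[t] = 0 -> e * t ^+ n = - e ->
  quaternion_alg (subvs_of (block e)) /\ matrix2_alg (subvs_of (block e)).
Proof.
move=> ide ef et; have [g gE] := block_proj ide; have [_ _ cen_e] := ide.
have eqg u v : e * u = e * v -> g u = g v.
  by move=> euv; apply: val_inj; rewrite /= !gE.
have sur r : r = g (vsval r).
  apply: val_inj; rewrite /= gE; apply/esym/eqP; rewrite -memv_block //.
  exact: subvsP.
apply: (@quaternion_of_gens _ _ (f i) (g t) (g x) (g y)) => //.
- by rewrite -horner_alg_morph -(rmorph0 g); apply: eqg; rewrite ef mulr0.
- by move=> r; rewrite (sur r) -!rmorphM cen_t.
- by rewrite -rmorphM xx rmorph1.
- by rewrite -rmorphM yy rmorph1.
- rewrite -!rmorphM -rmorphN; apply: eqg.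
  by rewrite xy mulrA -(cen_e (y * x)) -mulrA et !mulrN cen_e.
move=> r; have [[[q1 q2] [q3 q4]] /= rE] := gen (vsval r).
exists ((q1, q2), (q3, q4)) => /=.
rewrite {1}(sur r) rE rmorphD /= !rmorphM /= !rmorphD /= !rmorphM /=.
by rewrite !horner_alg_morph.
Qed.

Lemma twisted_decomposition : exists Fs Ms : seq {aspace A},
  [/\ wedderburn_decomposition (Fs ++ Ms),
      size Fs = (4 * size Ps)%N, size Ms = size Qs,
      forall B : {aspace A}, B \in Fs -> field_alg (subvs_of B)
    & forall B : {aspace A}, B \in Ms ->
        quaternion_alg (subvs_of B) /\ matrix2_alg (subvs_of B)].
Proof.
have size_f i : (1 < size (f i))%N by case: (irr_f i).
have [eps [orth_eps sum_eps eps_f nz_eps]] := chinese_idempotents size_f co_f.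
(* A factor of X^n - 1 gives four idempotents, one for each choice (b, c) of the signs of [x] and
   [y]; a factor of X^n + 1 gives one. *)
pose I := ('I_(size Ps) * bool * bool + 'I_(size Qs))%type.
pose E (i : I) : A := match i with
  | inl (j, b, c) => (eps (inl j)).[t] * half x b * half y c
  | inr j => (eps (inr j)).[t] end.
pose p (i : I) : pI := match i with inl (j, _, _) => inl j | inr j => inr j end.
have E_eps i : exists a, E i = (eps (p i)).[t] * a.
  case: i => [[[j b] c]|j] /=; last by exists 1; rewrite mulr1.
  by exists (half x b * half y c); rewrite mulrA.
have com j : (eps (inl j)).[t] * (x * y) = (eps (inl j)).[t] * (y * x).
  by rewrite xy mulrA ht -mulrA (tn (eps_f (inl j))).
have hh (u : A) b : u * half u b = half u b * u.
  by have /esym := @half_comm K A u u 1 b erefl; rewrite !mul1r.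
have Bx j c : (eps (inl j)).[t] * (half y c * x) = (eps (inl j)).[t] * (x * half y c).
  by apply: half_comm; rewrite com.
have Ay j b : (eps (inl j)).[t] * (half x b * y) = (eps (inl j)).[t] * (y * half x b).
  by apply: half_comm; rewrite com.
have AB j b c : (eps (inl j)).[t] * half x b * half y c =
    (eps (inl j)).[t] * half y c * half x b.
  by rewrite -!mulrA; apply: half_comm; rewrite Bx.
have cenE i a : a * E i = E i * a.
  case: i => [[[j b] c]|j] /=; last by rewrite ht.
  apply: cen_of.
    set e := (eps (inl j)).[t].
    have -> : e * half x b * half y c * x = half x b * (e * (half y c * x)).
      by rewrite [e * half x b]ht !mulrA.
    by rewrite Bx !mulrA -[x * e]ht -[half x b * e]ht -(mulrA e _ x) -hh mulrA.
  set e := (eps (inl j)).[t].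
  by rewrite -(mulrA _ _ y) -hh !mulrA -(mulrA e) Ay -[y * e]ht mulrA.
have orthE i j : i != j -> E i * E j = 0.
  (* Over different polynomial factors the [eps] are orthogonal; over the same factor the signs of
     [x] or of [y] differ and [half_orth] applies. *)
  have [eq_p | ne_p] := eqVneq (p i) (p j); last first.
    have [[a ->] [b ->]] := (E_eps i, E_eps j).
    by rewrite mulrA -(mulrA _ a) -ht mulrA -rmorphM /= NtE ?orth_eps // !mul0r.
  case: i j eq_p => [[[j b] c]|j] [[[j' b'] c']|j'] //= [<-]; last by rewrite eqxx.
  have [<-{b'} | neb _] := eqVneq b b'; last first.
    have /= cF a := cenE (inl (j, b', c')) a.
    rewrite -(mulrA _ (half y c)) cF !mulrA.
    rewrite -(mulrA _ _ (eps (inl j)).[t]) -ht mulrA -(mulrA _ (half x b)).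
    by rewrite half_orth // mulr0 !mul0r.
  have [<- | nec _] := eqVneq c c'; first by rewrite eqxx.
  rewrite (AB j b c') !mulrA -(mulrA _ _ (eps (inl j)).[t]) -ht !mulrA.
  by rewrite -(mulrA _ (half y c)) half_orth // mulr0 !mul0r.
have sumE : \sum_i E i = 1.
  have -> : \sum_i E i = \sum_i (eps i).[t].
    rewrite !big_sumType /=; congr (_ + _).
    transitivity (\sum_j \sum_b \sum_c (eps (inl j)).[t] * half x b * half y c).
      by rewrite !pair_bigA; apply: eq_bigr => [[[j b] c]].
    apply: eq_bigr => j _; under eq_bigr => b _ do rewrite -mulr_sumr sum_half // mulr1.
    by rewrite -mulr_sumr sum_half // mulr1.
  rewrite -rmorph_sum; apply/eqP; rewrite -subr_eq0 -[X in _ - X](rmorph1 (horner_alg t)).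
  by rewrite -rmorphB /= NtE.
have nzE i : E i != 0.
  case: i => [[[j b] c]|j] /=; apply/negP; last first.
    move=> /eqP e0; have := indep (q1 := eps (inr j)) (q2 := 0) (q3 := 0) (q4 := 0).
    rewrite -(eqp_dvdl _ NE) (negPf (nz_eps _)) => H; suff : false by []; apply: H.
    by rewrite e0 !rmorph0 !mul0r !addr0 mul0r addr0.
  rewrite /half -!(scalerAr, scalerAl) !scaler_eq0 invr_eq0 (negPf nz2) /= => /eqP e0.
  set e := eps (inl j) in e0.
  (* Up to an invertible scalar, the idempotent is [e] at t times (1 + (-1)^b x) (1 + (-1)^c y). Its
     expansion has [e] as coefficient of 1, and [N] does not divide [e]. *)
  have := indep (q1 := e) (q2 := e * (-1) ^+ b) (q3 := e * (-1) ^+ c)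
                (q4 := e * (-1) ^+ b * (-1) ^+ c).
  rewrite -(eqp_dvdl _ NE) (negPf (nz_eps _)) => H; suff : false by []; apply: H.
  rewrite -{}[RHS]e0 !rmorphM !rmorph_sign /= !mulrDr !mulrDl !mulr1 !mulrA.
  by rewrite -(mulrA _ x ((-1) ^+ c)) (commr_sign x) mulrA.
have ide := orth_central_idem nzE cenE orthE sumE.
have Ef i : E i * (f (p i)).[t] = 0.
  by have [a ->] := E_eps i; rewrite -ht mulrA -rmorphM [_ * eps _]mulrC /= NtE ?mul0r.
have fieldE j b c : field_alg (subvs_of (block (E (inl (j, b, c))))).
  apply: (block_field_alg (ide _) (Ef _)) .
    by rewrite -cenE /= !mulrA -ht -(mulrA _ x) hh half_absorb // mulrA commr_sign -!mulrA.
  by rewrite /= -(mulrA _ _ y) half_absorb // mulrA commr_sign -!mulrA.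
have quatE j := block_quaternion (ide (inr j)) (Ef _) (tnN (eps_f (inr j))).
pose rF := [seq inl i | i <- enum {: 'I_(size Ps) * bool * bool}] : seq I.
pose rQ := [seq inr i | i <- enum 'I_(size Qs)] : seq I.
exists [seq block (E i) | i <- rF], [seq block (E i) | i <- rQ]; split.
- rewrite -map_cat; apply: wedderburn_of_idems => //.
    apply: uniq_perm; [|exact: enum_uniq|move=> i].
    - have [injF injQ] : injective (@inl _ 'I_(size Qs) : _ -> I) /\
          injective (@inr ('I_(size Ps) * bool * bool) _ : _ -> I).
        by split=> ? ? [].
      rewrite /rF /rQ cat_uniq (map_inj_uniq injF) (map_inj_uniq injQ) !enum_uniq andbT.
      by apply/hasPn=> _ /mapP[j _ ->]; apply/negP=> /mapP[].
    - rewrite mem_cat mem_enum; case: i => i.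
        by rewrite map_f ?mem_enum.
      by rewrite orbC map_f ?mem_enum.
  case=> [[[j b] c]|j]; first exact/field_alg_simple/fieldE.
  by case: (quatE j) => -[].
- by rewrite size_map /rF size_map -cardE !card_prod card_bool card_ord -mulnA mulnC.
- by rewrite size_map /rQ size_map -cardE card_ord.
- by move=> _ /mapP[_ /mapP[[[j b] c] _ ->] ->].
by move=> _ /mapP[_ /mapP[j _ ->] ->].
Qed.

End Decomposition.

(** * Normal forms and basis elements in the group algebra *)

Lemma horner_algE (K : fieldType) (A : algType K) (a : A) (q : {poly K}) :
  horner_alg a q = \sum_(i < size q) q`_i *: a ^+ i.
Proof.
rewrite [LHS](@horner_coef_wide _ (size q)) ?size_poly //.
by apply: eq_bigr => i _; rewrite coef_map /= mulr_algl.
Qed.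

Lemma horner_alg_modp (K : fieldType) (A : algType K) (a : A) (n : nat) (q : {poly K}) :
  a ^+ n = 1 -> horner_alg a (q %% ('X^n - 1)) = horner_alg a q.
Proof.
move=> an1; rewrite [in RHS](divp_eq q ('X^n - 1)) rmorphD rmorphM rmorphB /= rmorphXn /=.
by rewrite horner_algX an1 rmorph1 subrr mulr0 add0r.
Qed.

Section NormalForm.

Variables (K : fieldType) (A : falgType K) (t x y : A).

Definition normal_form (q : {poly K} * {poly K} * ({poly K} * {poly K})) : A :=
  horner_alg t q.1.1 + horner_alg t q.1.2 * x
  + (horner_alg t q.2.1 + horner_alg t q.2.2 * x) * y.

Lemma normal_formD q q' : normal_form q + normal_form q' =
  normal_form ((q.1.1 + q'.1.1, q.1.2 + q'.1.2), (q.2.1 + q'.2.1, q.2.2 + q'.2.2)).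
Proof.
rewrite /normal_form /= !rmorphD /= !mulrDl addrACA.
by congr (_ + _); rewrite addrACA.
Qed.

Lemma normal_form_sum (I : finType) (r : I -> A) :
  (forall i, exists q, r i = normal_form q) -> exists q, \sum_i r i = normal_form q.
Proof.
move=> form_r; elim/big_ind: _ => [|r1 r2 [q ->] [q' ->]|i _].
- by exists ((0, 0), (0, 0)); rewrite /normal_form /= !rmorph0 !(mul0r, addr0).
- by rewrite normal_formD; eexists.
exact: form_r.
Qed.

Lemma normal_form_monomial (c : K) (i : nat) (a b : bool) :
  exists q, c *: (t ^+ i * x ^+ a * y ^+ b) = normal_form q.
Proof.
pose q : {poly K} := c *: 'X^i.
have qE : horner_alg t q = c *: t ^+ i.
  by rewrite /q -[c *: 'X^i]addr0 horner_alg_linear rmorph0 addr0 rmorphXn /= horner_algX.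
exists ((if a || b then 0 else q, if a && ~~ b then q else 0),
        (if ~~ a && b then q else 0, if a && b then q else 0)).
by case: a b => [] [];
  rewrite /normal_form /= !rmorph0 qE ?expr0 ?expr1 ?mulr1 ?scalerAl ?scalerAl
    !(mul0r, addr0, add0r).
Qed.

End NormalForm.

Section GroupElements.

Variables (K : fieldType) (gT : finGroupType).

Definition galg (g : gT) : group_alg K gT := [ffun h => (h == g)%:R].

Lemma galg1 : galg 1%g = 1.
Proof. by []. Qed.

Lemma galgM g h : galg (g * h)%g = galg g * galg h.
Proof.
have -> : galg g * galg h = group_alg_mul (galg g) (galg h) by [].
apply/ffunP=> k; rewrite !ffunE (bigD1 g) //= big1 => [|l /negPf nl].
  rewrite !ffunE eqxx mul1r addr0; congr (nat_of_bool _)%:R.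
  by apply/eqP/eqP=> [->|<-]; rewrite ?mulKg ?mulKVg.
by rewrite !ffunE nl mul0r.
Qed.

Lemma galgX g n : galg (g ^+ n)%g = galg g ^+ n.
Proof. by elim: n => [|n IHn]; rewrite ?expg0 ?galg1 // expgS galgM IHn exprS. Qed.

Lemma galg_sum (a : group_alg K gT) : a = \sum_g (a g : K) *: galg g.
Proof.
apply/ffunP=> h; rewrite sum_ffunE (bigD1 h) //= big1 => [|g /negPf ng].
  by rewrite !ffunE eqxx addr0 [RHS]mulr1.
by rewrite !ffunE eq_sym ng [LHS]mulr0.
Qed.

Lemma galg_commute g h : commute g h -> galg g * galg h = galg h * galg g.
Proof. by move=> gh; rewrite -!galgM gh. Qed.

End GroupElements.

(** An instance of [twisted_decomposition], whose independence hypothesis comes from the uniqueness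
    of the normal form t^i x^a y^b of group elements. *)
Lemma d1_wedderburn (K : fieldType) (gT : finGroupType) (m : nat) (Ps Qs : seq {poly K}) :
  2%:R != 0 :> K ->
  ([set: gT] \isog Grp (t : x : y :
     t ^+ (2 ^ m.+1), x ^+ 2, y ^+ 2, [~ t, x], [~ t, y],
     [~ x, y] = t ^+ (2 ^ m)))%g ->
  factorization ('X^(2 ^ m) - 1) Ps -> factorization ('X^(2 ^ m) + 1) Qs ->
  exists Fs Ms : seq {aspace group_alg K gT},
  [/\ wedderburn_decomposition (Fs ++ Ms),
      size Fs = (4 * size Ps)%N, size Ms = size Qs,
      forall B : {aspace group_alg K gT}, B \in Fs -> field_alg (subvs_of B)
    & forall B : {aspace group_alg K gT}, B \in Ms ->
        quaternion_alg (subvs_of B) /\ matrix2_alg (subvs_of B)].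
Proof.
move=> nz2 /d1_normal_form[t [x [y [[t1 xx yy] [tx ty xy] [phi' phiK phi'K]]]]] facP facQ.
have gen (r : group_alg K gT) : exists q : {poly K} * {poly K} * ({poly K} * {poly K}),
    r = horner_alg (galg K t) q.1.1 + horner_alg (galg K t) q.1.2 * galg K x
      + (horner_alg (galg K t) q.2.1 + horner_alg (galg K t) q.2.2 * galg K x) * galg K y.
  rewrite [r]galg_sum; apply: normal_form_sum => g.
  have -> : galg K g =
      galg K t ^+ (phi' g).1.1 * galg K x ^+ (phi' g).1.2 * galg K y ^+ (phi' g).2.
    by rewrite -!galgX -!galgM phi'K.
  exact: normal_form_monomial.
apply: (@twisted_decomposition _ _ (2 ^ m) (galg K t) (galg K x) (galg K y)) => //.
- by rewrite natrX expf_neq0.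
- move=> r; rewrite [r]galg_sum mulr_sumr mulr_suml; apply: eq_bigr => g _.
  rewrite -scalerAr -scalerAl; congr (_ *: _); apply: galg_commute.
  rewrite -[g]phi'K; apply: commuteM; last exact: commuteX.
  by apply: commuteM; [exact/commuteX/commute_refl | exact: commuteX].
- by rewrite -galgM xx.
- by rewrite -galgM yy.
- by rewrite -galgM xy !galgM galgX.
- by rewrite -galgX -expnSr t1.
have t_mod j : (t ^+ j = t ^+ (j %% 2 ^ m.+1))%g by rewrite expg_mod.
have inj := can_inj phiK.
have lt_mod j : (j %% 2 ^ m.+1 < 2 ^ m.+1)%N by rewrite ltn_mod expn_gt0.
have off (i : 'I_(2 ^ m.+1)) (j : nat) (a b : bool) : a || b ->
    (t ^+ i == t ^+ j * (x ^+ a * y ^+ b))%g = false.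
  move=> ab; apply/eqP; rewrite (t_mod j) mulgA => eq_ij.
  have := inj (i, false, false) (Ordinal (lt_mod j), a, b).
  by rewrite /= !expg0 !mulg1 => /(_ eq_ij) [] _ ea eb; rewrite -ea -eb in ab.
have ev (q : {poly K}) (i : 'I_(2 ^ m.+1)) (u : gT) :
    (horner_alg (galg K t) q * galg K u) (t ^+ i)%g
    = \sum_(j < size q) q`_j * (t ^+ i == t ^+ j * u)%g%:R.
  rewrite horner_algE mulr_suml sum_ffunE; apply: eq_bigr => j _.
  by rewrite -scalerAl -galgX -galgM !ffunE.
have ev0 (q : {poly K}) (i : 'I_(2 ^ m.+1)) (a b : bool) : a || b ->
    (horner_alg (galg K t) q * galg K (x ^+ a * y ^+ b)%g) (t ^+ i)%g = 0.
  by move=> ab; rewrite ev big1 // => j _; rewrite off // mulr0.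
move=> q1 q2 q3 q4; pose N : {poly K} := 'X^(2 ^ m * 2) - 1.
(* After reduction modulo [N], the degree is below the order of [t], so the coefficients sit at
   distinct powers of [t]. *)
have <- : horner_alg (galg K t) (q1 %% N) = horner_alg (galg K t) q1.
  by apply: horner_alg_modp; rewrite -galgX -expnSr t1.
move=> eq0; apply/eqP/polyP=> i; rewrite coef0 -/N.
have size_r : (size (q1 %% N)%R <= 2 ^ m.+1)%N.
  have sizeN : size N = (2 ^ m.+1).+1 by rewrite size_XnsubC ?expnSr // muln_gt0 expn_gt0.
  by rewrite -ltnS -sizeN ltn_modp -size_poly_eq0 sizeN.
have [le_i | lt_i] := leqP (2 ^ m.+1) i.
  by rewrite nth_default // (leq_trans size_r).
pose k := Ordinal lt_i.
have [lt_si | le_si] := leqP (size (q1 %% N)%R) i; first by rewrite nth_default.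
(* At the group element t^i the terms with [x] or [y] vanish, and only the coefficient of degree [i]
   of the remainder is left. *)
move/ffunP/(_ (t ^+ i)%g): eq0.
rewrite mulrDl -mulrA -galgM -[horner_alg _ (q1 %% N)]mulr1 -galg1.
have evx := ev0 q2 k true false isT; have evy := ev0 q3 k false true isT.
have evxy := ev0 q4 k true true isT; move: evx evy evxy.
rewrite /= !expg0 !expg1 mulg1 mul1g => evx evy evxy.
have addE (r1 r2 : group_alg K gT) g : (r1 + r2) g = r1 g + r2 g by rewrite ffunE.
rewrite !addE evx evy evxy !addr0 (ev _ k) (bigD1 (Ordinal le_si)) //=.
rewrite big1 => [|j nj]; rewrite ?ffunE.
  by rewrite mulg1 eqxx mulr1 addr0.
have lt_j : (j < 2 ^ m.+1)%N by apply: leq_trans size_r.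
rewrite mulg1; case: eqP => [eq_ij|]; last by rewrite mulr0.
have := inj (k, false, false) (Ordinal lt_j, false, false).
rewrite /= !expg0 !mulg1 => /(_ eq_ij) [ij].
by rewrite -val_eqE /= ij eqxx in nj.
Qed.

(** * Counting irreducible factors *)

Section Factorizations.

Variable K : fieldType.
Implicit Types (p q : {poly K}) (s : seq {poly K}).

Lemma factorization_cat p q s1 s2 :
  factorization p s1 -> factorization q s2 -> factorization (p * q) (s1 ++ s2).
Proof.
move=> [p_s1 irr1] [q_s2 irr2]; split=> [|r].
  by rewrite big_cat (eqp_trans (eqp_mulr _ p_s1)) ?eqp_mull.
by rewrite mem_cat => /orP[/irr1 | /irr2].
Qed.

Lemma factorization_irreducible p : irreducible_poly p -> factorization p [:: p].
Proof. by move=> irr_p; split=> [|q]; rewrite ?big_seq1 ?eqpxx // inE => /eqP->. Qed.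

Lemma irreducible_poly_size2 p : size p = 2 -> irreducible_poly p.
Proof.
move=> size_p; have nz_p : p != 0 by rewrite -size_poly_eq0 size_p.
split=> [|q size_q q_p]; first by rewrite size_p.
rewrite -dvdp_size_eqp // size_p eqn_leq -{1}size_p dvdp_leq //=.
rewrite ltn_neqAle eq_sym size_q size_poly_gt0.
by apply: contraTneq q_p => ->; rewrite dvd0p.
Qed.

Lemma factorization_size_gt0 p s : (1 < size p)%N -> factorization p s -> (0 < size s)%N.
Proof.
move=> size_p [p_s _]; case: s p_s => // /eqp_size.
by rewrite big_nil size_poly1 => size1; rewrite size1 in size_p.
Qed.

(** A single irreducible factor would be associate to p * q and, being divisible by the nonconstant
    [p], also to [p], which has smaller degree. *)
Lemma factorization_size_gt1 p q s :
  (1 < size p)%N -> (1 < size q)%N -> factorization (p * q) s -> (1 < size s)%N.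
Proof.
move=> size_p size_q fac_s; have [pq_s irr_s] := fac_s.
have nz_p : p != 0 by rewrite -size_poly_gt0 ltnW.
have nz_q : q != 0 by rewrite -size_poly_gt0 ltnW.
have size_pq : (size p < size (p * q)%R)%N.
  rewrite size_mul //; case: (size q) size_q => [|[|n]] // _.
  by rewrite !addnS ltnS leq_addr.
have := factorization_size_gt0 (ltn_trans size_p size_pq) fac_s.
case: s pq_s irr_s {fac_s} => [|r [|//]] // pq_r irr_s _.
rewrite big_seq1 in pq_r; have [_ irr_r] := irr_s r (mem_head _ _).
have p_r : p %| r by rewrite -(eqp_dvdr _ pq_r) dvdp_mulr.
have /irr_r/(_ p_r)/eqp_size size_pr : size p != 1%N by lia.
by move: size_pq; rewrite (eqp_size pq_r) size_pr ltnn.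
Qed.

(** Degrees add up in the product; as [size] is the degree plus one, [d] bounds the degree of each
    factor from below. *)
Lemma factorization_size_le p s (d : nat) :
  p != 0 -> factorization p s -> (forall q, q \in s -> q %| p -> (d < size q)%N) ->
  (size s * d < size p)%N.
Proof.
move=> nz_p [p_s _] lt_d.
have {}lt_d q : q \in s -> (d < size q)%N.
  by move=> s_q; apply: lt_d => //; rewrite (eqp_dvdr _ p_s) (big_rem q) //= dvdp_mulr.
rewrite (eqp_size p_s); have {nz_p} : \prod_(q <- s) q != 0.
  by rewrite -size_poly_eq0 -(eqp_size p_s) size_poly_eq0.
elim: s lt_d {p_s} => [|q s IHs] lt_d; first by rewrite big_nil size_poly1.
rewrite big_cons mulf_eq0 => /norP[nz_q nz_s]; rewrite size_mul //= mulSn.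
have := lt_d q (mem_head _ _); case: (size q) => // n; rewrite ltnS => le_dn.
rewrite addSn -addnS leq_add // IHs // => r s_r.
by apply: lt_d; rewrite inE s_r orbT.
Qed.

(** X^(2^k) - 1 is X - 1 times the product of the X^(2^i) + 1 for i < k. The condition [E] makes the
    counts exact: it will be [True] over the rationals and q = 3 mod 8 over a finite field. *)
Lemma factorization_2power (c : nat -> nat) (E : Prop) :
  (forall k, exists s, [/\ factorization ('X^(2 ^ k) + 1 : {poly K}) s,
      (c k <= size s)%N & E -> size s = c k]) ->
  forall k, exists s, [/\ factorization ('X^(2 ^ k) - 1 : {poly K}) s,
      (1 + \sum_(i < k) c i <= size s)%N & E -> size s = (1 + \sum_(i < k) c i)%N].
Proof.
move=> fac_c; elim=> [|k [s [fac_s le_s eq_s]]].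
  exists [:: 'X - 1]; rewrite big_ord0; split=> //.
  by apply/factorization_irreducible/irreducible_poly_size2; rewrite size_XsubC.
have [s' [fac_s' le_s' eq_s']] := fac_c k.
exists (s ++ s'); rewrite size_cat big_ord_recr /= addnA leq_add //; split=> //.
  by rewrite expnSr exprM subr_sqr_1; apply: factorization_cat.
by move=> e; rewrite eq_s // eq_s'.
Qed.

End Factorizations.

(** * The factors of X^(2^k) + 1 over a finite field, then over the rationals *)

Lemma factorization_exists (K : finFieldType) (p : {poly K}) :
  p != 0 -> exists s, factorization p s.
Proof.
have [n] := ubnP (size p); elim: n p => // n IHn p; rewrite ltnS => le_n nz_p.
have [size_p | size_p] := leqP (size p) 1.
  exists [::]; split=> [|q]; last by rewrite in_nil.
  rewrite big_nil -size_poly_eq1 eqn_leq size_p size_poly_gt0 //.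
have [/irreducibleP irr_p | ] := boolP (irreducibleb p).
  by exists [:: p]; apply: factorization_irreducible.
rewrite /irreducibleb size_p /= => /forallPn[/= q].
rewrite negb_imply -ltnNge -Pdiv.Idomain.dvdpE => /andP[/dvdpP[r def_p] size_q].
have lt_q : (size q < size p)%N.
  by rewrite (leq_ltn_trans (size_npoly q)) // ltn_predL ltnW.
move: (q : {poly K}) def_p size_q lt_q => {}q def_p size_q lt_q.
have /norP[nz_r nz_q] : ~~ ((r == 0) || (q == 0)) by rewrite -mulf_eq0 -def_p.
have lt_r : (size r < size p)%N.
  rewrite def_p size_mul //; case: (size q) size_q => [|[|n']] // _.
  by rewrite !addnS ltnS leq_addr.
have [|//|s1 fac1] := IHn r; first exact: leq_trans le_n.
have [|//|s2 fac2] := IHn q; first exact: leq_trans le_n.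
by exists (s1 ++ s2); rewrite def_p; apply: factorization_cat.
Qed.

Lemma finField_generator (K : finFieldType) :
  exists g : K, forall a, a != 0 -> exists i, a = g ^+ i.
Proof.
have /cyclicP[g defG] := field_unit_group_cyclic [group of [set: {unit K}]].
exists (val g) => a; rewrite -unitfE => Ua.
have : FinRing.unit K Ua \in <[g]>%g by rewrite -defG inE.
by case/cycleP=> i eq_a; exists i; rewrite -FinRing.val_unitX -eq_a.
Qed.

(** The unit group is cyclic: if -1 and 2 are both odd powers of a generator, their product is an
    even one. *)
Lemma finField_square (K : finFieldType) : (2%:R : K) != 0 ->
  exists a : K, [\/ a ^+ 2 = -1, a ^+ 2 = 2%:R | a ^+ 2 = - 2%:R].
Proof.
move=> nz2; have [g gen_g] := finField_generator K.
have [i gi] : exists i, -1 = g ^+ i by apply: gen_g; rewrite oppr_eq0 oner_eq0.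
have [j gj] := gen_g _ nz2.
have sq k : ~~ odd k -> (g ^+ k./2) ^+ 2 = g ^+ k.
  by move=> even_k; rewrite -exprM muln2 even_halfK.
have [odd_i | even_i] := boolP (odd i); last first.
  by exists (g ^+ i./2); apply: Or31; rewrite sq.
have [odd_j | even_j] := boolP (odd j); last first.
  by exists (g ^+ j./2); apply: Or32; rewrite sq.
exists (g ^+ (i + j)./2); apply: Or33; rewrite sq ?oddD ?odd_i ?odd_j //.
by rewrite exprD -gi -gj mulN1r.
Qed.

Section Quartic.

Variable K : fieldType.
Implicit Types b c : K.

Definition quad b c : {poly K} := 'X^2 + b *: 'X + c%:P.

Lemma size_quad b c : size (quad b c) = 3.
Proof.
rewrite /quad -addrA size_polyDl ?size_polyXn //.
rewrite (leq_ltn_trans (size_polyD _ _)) // gtn_max.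
rewrite (leq_ltn_trans (size_scale_leq _ _)) ?size_polyX //.
by rewrite (leq_ltn_trans (size_polyC_leq1 _)).
Qed.

Lemma quadM b c : quad b c * quad (- b) c =
  'X^4 + (c *+ 2 - b ^+ 2) *: 'X^2 + (c ^+ 2)%:P.
Proof.
rewrite /quad -!mul_polyC !(rmorphN, rmorphB, rmorphMn, rmorphXn) /=; ring.
Qed.

Lemma quadM0 c d : quad 0 c * quad 0 d = 'X^4 + (c + d) *: 'X^2 + (c * d)%:P.
Proof. by rewrite /quad -!mul_polyC !(rmorphD, rmorphM) /= rmorph0; ring. Qed.

End Quartic.

(** X^4 + 1 is a product of two quadratics, and X^(2^k) + 1 arises from it by substituting
    X^(2^(k-2)). *)
Lemma factorization_X2k_add1_gt1 (K : finFieldType) (k : nat) (s : seq {poly K}) :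
  (2%:R : K) != 0 -> (1 < k)%N -> factorization ('X^(2 ^ k) + 1) s -> (1 < size s)%N.
Proof.
move=> nz2 k_gt1.
have [p [q [size_p size_q def4]]] : exists p q : {poly K},
    [/\ size p = 3, size q = 3 & p * q = 'X^4 + 1].
  (* Each case writes X^4 + 1 as a difference of squares: (X^2)^2 - a^2, (X^2 + 1)^2 - (a X)^2 and
     (X^2 - 1)^2 - (a X)^2 respectively. *)
  have [a [a2 | a2 | a2]] := finField_square nz2.
  - exists (quad 0 a), (quad 0 (- a)); rewrite !size_quad quadM0; split=> //.
    by rewrite subrr scale0r addr0 mulrN -expr2 a2 opprK.
  - exists (quad a 1), (quad (- a) 1); rewrite !size_quad quadM; split=> //.
    by rewrite a2 subrr scale0r addr0 expr1n.
  exists (quad a (-1)), (quad (- a) (-1)); rewrite !size_quad quadM; split=> //.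
  by rewrite a2 mulNrn opprK addNr scale0r addr0 sqrrN expr1n.
pose Y : {poly K} := 'X^(2 ^ k.-2).
have -> : 'X^(2 ^ k) + 1 = (p \Po Y) * (q \Po Y).
  rewrite -comp_polyM def4 comp_polyD comp_polyC comp_Xn_poly /Y -exprM.
  by rewrite -[4%N]/(2 ^ 2)%N -expnD -subn2 subnK.
have size_Y (r : {poly K}) : size r = 3 -> (1 < size (r \Po Y))%N.
  move=> size_r; have := size_comp_poly r Y; rewrite size_r size_polyXn /=.
  have : (0 < 2 ^ k.-2)%N by rewrite expn_gt0.
  by case: (size _) => [|[|]] //; case: (2 ^ _)%N.
exact: factorization_size_gt1 (size_Y _ size_p) (size_Y _ size_q).
Qed.

(** The 2-adic valuation of q^(2^(j+1) r) - 1 is thus exactly j + 3: it starts at 3 because q^2 is 9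
    modulo 16, and each squaring raises it by one. *)
Lemma expn_3mod8 (q j r : nat) : (q %% 8 = 3)%N -> odd r ->
  exists w, (q ^ (2 ^ j.+1 * r) = 1 + 2 ^ (j + 3) * w.*2.+1)%N.
Proof.
move=> q3 odd_r; elim: j => [|j [w IHj]].
  have q2 : (q ^ 2 = 9 %[mod 16])%N.
    rewrite [in LHS](divn_eq q 8) q3; set a := (q %/ 8)%N.
    have -> : ((a * 8 + 3) ^ 2 = (4 * (a * a) + 3 * a) * 16 + 9)%N by nia.
    by rewrite modnMDl.
  (* Since 9^2 is 1 modulo 16, odd powers of 9 are 9; then q^(2 r) = 16 w + 9 = 1 + 8 (2 w + 1). *)
  have q2r : (q ^ (2 * r) = 9 %[mod 16])%N.
    rewrite expnM -modnXm q2 modnXm -(odd_double_half r) odd_r expnS -mul2n expnM.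
    by rewrite -modnMmr -modnXm exp1n.
  exists (q ^ (2 * r) %/ 16)%N; rewrite expn1 [LHS](divn_eq _ 16) q2r; lia.
(* With v = 2 w + 1, the square of 1 + 2^(j+3) v is 1 + 2^(j+4) (v + 2^(j+2) v^2); the witness is
   half of that odd cofactor, rounded down. *)
exists (w + 2 ^ j.+1 * w.*2.+1 ^ 2)%N.
rewrite expnSr mulnAC expnM IHj addSn !expnS !expnD; set A := (2 ^ j)%N; nia.
Qed.

(** The factor [(1 < k).+1], the future number of irreducible factors of X^(2^k) + 1, is 1 up to k =
    1 and 2 beyond. For odd d, q^d is 3 modulo 4, so k = 0. For d = 2^(j+1) m with m odd,
    [expn_3mod8] gives k + 1 <= j + 3, whence 2^k <= 2 d; for k = 1 it is enough that d is even. *)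
Lemma dvdn_2power_3mod8 (q d k : nat) : (q %% 8 = 3)%N -> (0 < d)%N ->
  (2 ^ k.+1 %| q ^ d - 1)%N -> (2 ^ k <= d * (1 < k).+1)%N.
Proof.
move=> q3 d_gt0; case: k => [|k] dvd_k; first by rewrite muln1.
have [m co_m def_d] := pfactor_coprime (isT : prime 2) d_gt0.
rewrite coprime2n in co_m; move: def_d dvd_k; case: (logn 2 d) => [|j] -> dvd_k.
  rewrite expn0 muln1 in dvd_k.
  have q2 : (q ^ 2 = 1 %[mod 4])%N.
    rewrite [in LHS](divn_eq q 8) q3; set a := (q %/ 8)%N.
    have -> : ((a * 8 + 3) ^ 2 = (16 * (a * a) + 12 * a + 2) * 4 + 1)%N by nia.
    by rewrite modnMDl.
  have qm : (q ^ m = 3 %[mod 4])%N.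
    rewrite -(odd_double_half m) co_m expnS -mul2n expnM -modnMmr -modnXm q2 modnXm exp1n.
    by rewrite modnMmr muln1 (divn_eq q 8) q3 -[8%N]/(2 * 4)%N mulnA modnMDl.
  have : (4 %| q ^ m - 1)%N
    by apply: dvdn_trans dvd_k; rewrite (dvdn_exp2l 2 (_ : 2 <= _)%N).
  by rewrite (divn_eq (q ^ m) 4) qm -addnBA // dvdn_addr ?dvdn_mull.
have [w qE] := expn_3mod8 j q3 co_m.
move: dvd_k; rewrite mulnC qE addKn => dvd_k.
have le_kj : (k.+2 <= j + 3)%N.
  rewrite leqNgt; apply/negP=> lt_jk.
  have : (2 ^ (j + 4) %| 2 ^ (j + 3) * w.*2.+1)%N
    by apply: dvdn_trans dvd_k; rewrite dvdn_exp2l // addnS.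
  by rewrite addnS expnSr dvdn_pmul2l ?expn_gt0 // dvdn2 /= odd_double.
have m_gt0 : (0 < m)%N by case: (m) co_m.
case: k {dvd_k} le_kj => [|k] le_kj.
  by have := expn_gt0 2 j; rewrite muln1 !expnS expn0; nia.
have le2 : (2 ^ k.+2 <= 2 ^ j.+2)%N by rewrite leq_exp2l //; lia.
have -> : (1 < k.+2)%N.+1 = 2 by [].
by move: le2; rewrite !expnS; nia.
Qed.

Lemma prim_root_2power (L : fieldType) (z : L) (k : nat) :
  (2%:R : L) != 0 -> z ^+ (2 ^ k) = -1 -> (2 ^ k.+1).-primitive_root z.
Proof.
move=> nz2 zk; have z1 : z ^+ (2 ^ k.+1) = 1.
  by rewrite expnSr exprM zk sqrrN expr1n.
have [m prim_z] := prim_order_exists (expn_gt0 2 k.+1) z1.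
case/(dvdn_pfactor _ _ (isT : prime 2)) => j.
rewrite leq_eqVlt ltnS => /orP[/eqP<- <- //|le_jk def_m].
have : z ^+ (2 ^ k) == 1 by rewrite -(prim_order_dvd prim_z) def_m dvdn_exp2l.
by rewrite zk eq_sym -subr_eq0 opprK -[1 + 1]/(2%:R) (negPf nz2).
Qed.

(** A root [z] of [g] lies in a field of q^d elements, with q the order of [K] and d the degree of
    [g], so z^(q^d - 1) = 1; and [z] has order 2^(k+1) because z^(2^k) = -1. *)
Lemma irreducible_factor_degree (K : finFieldType) (g : {poly K}) (k : nat) :
  (2%:R : K) != 0 -> irreducible_poly g -> g %| 'X^(2 ^ k) + 1 ->
  (2 ^ k.+1 %| #|K| ^ (size g).-1 - 1)%N.
Proof.
move=> nz2 irr_g g_dvd; have [L dimL [z gz0 _]] := irredp_FAdjoin irr_g.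
have zk : z ^+ (2 ^ k) = -1.
  have /dvdpP[h def_h] := g_dvd.
  have := congr1 (fun p => (map_poly (in_alg L) p).[z]) def_h.
  rewrite rmorphM hornerM (eqP gz0) mulr0 rmorphD rmorph1 /= map_polyXn.
  by rewrite hornerD hornerXn hornerC => /eqP; rewrite addr_eq0 => /eqP.
have nz2L : (2%:R : L) != 0.
  by rewrite -(rmorph_nat (in_alg L)) fmorph_eq0.
have prim_z := prim_root_2power nz2L zk.
have nz_z : z != 0.
  apply/eqP=> z0; have /eqP := zk.
  by rewrite z0 expr0n expn_eq0 /= eq_sym oppr_eq0 oner_eq0.
have := memvf z; rewrite (Fermat's_little_theorem {:L}%AS) dimL => /eqP zq.
rewrite (prim_order_dvd prim_z) -(inj_eq (mulIf nz_z)) mul1r -exprSr subn1 prednK ?zq //.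
by rewrite expn_gt0; case: #|K| (finNzRing_gt1 K).
Qed.

Lemma odd_card_neq0 (K : finFieldType) : odd #|K| -> (2%:R : K) != 0.
Proof.
move=> odd_K; apply/negP=> /eqP K2.
have ch2 : 2 \in [pchar K] by rewrite inE /= K2 eqxx.
have := finNzRing_gt1 K; move: odd_K; rewrite (card_pprimeChar ch2).
by case: (logn _ _) => // n; rewrite expnS oddM.
Qed.

(** The lower bound is reducibility for k >= 2. For the exact value, each factor has degree at least
    2^k divided by [(1 < k).+1], so there are at most [(1 < k).+1] of them. *)
Lemma factorization_finField (K : finFieldType) (k : nat) : odd #|K| ->
  exists s : seq {poly K}, [/\ factorization ('X^(2 ^ k) + 1) s,
    ((1 < k).+1 <= size s)%N & #|K| = 3 %[mod 8] -> size s = (1 < k).+1].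
Proof.
move=> /odd_card_neq0 nz2.
have size_p : size ('X^(2 ^ k) + 1 : {poly K}) = (2 ^ k).+1.
  by rewrite size_XnaddC // expn_gt0.
have nz_p : 'X^(2 ^ k) + 1 != 0 :> {poly K} by rewrite -size_poly_eq0 size_p.
have [s fac_s] := factorization_exists nz_p; exists s.
have ge_s : ((1 < k).+1 <= size s)%N.
  have [k_gt1 | _] := boolP (1 < k)%N.
    exact: (factorization_X2k_add1_gt1 nz2 k_gt1 fac_s).
  by apply: factorization_size_gt0 fac_s; rewrite size_p ltnS expn_gt0.
split=> // K3; apply/eqP; rewrite eqn_leq ge_s andbT.
have [e e_gt0 eE] : exists2 e, (0 < e)%N & (2 ^ k = e * (1 < k).+1)%N.
  case: (k) => [|[|j]]; [by exists 1 | by exists 2 | exists (2 ^ j.+1)%N].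
    by rewrite expn_gt0.
  by rewrite expnSr.
have lt_e q : q \in s -> q %| 'X^(2 ^ k) + 1 -> (e.-1 < (size q).-1)%N.
  move=> s_q q_dvd; have [_ /(_ q s_q) irr_q] := fac_s; have [size_q _] := irr_q.
  have := irreducible_factor_degree nz2 irr_q q_dvd.
  move/(dvdn_2power_3mod8 K3); rewrite eE; case: (size q) size_q => [|[|n]] // _.
  by move=> /(_ isT); rewrite leq_pmul2r // prednK.
have : (size s * e < size ('X^(2 ^ k) + 1 : {poly K})%R)%N.
  apply: factorization_size_le fac_s _ => // q s_q /(lt_e q s_q).
  by rewrite prednK //; case: (size q) => //; rewrite leqNgt e_gt0.
by rewrite size_p eE ltnS (mulnC e) leq_pmul2r.
Qed.

(** A primitive root of unity [z] of order 2^(k+1) is a root, and its minimal polynomial has degree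
    2^k, so it is this polynomial up to a unit. In a product of two factors, one has the root [z]
    and is divisible by the whole. *)
Lemma irreducible_X2k_add1_rat (k : nat) : irreducible_poly ('X^(2 ^ k) + 1 : {poly rat}).
Proof.
have n_gt0 : (0 < 2 ^ k)%N by rewrite expn_gt0.
set p : {poly rat} := 'X^(2 ^ k) + 1.
have size_p : size p = (2 ^ k).+1 by rewrite size_XnaddC.
have [z prim_z] := C_prim_root_exists (expn_gt0 2 k.+1).
have zk : z ^+ (2 ^ k) = -1.
  have := prim_expr_order prim_z; rewrite expnSr exprM => /eqP.
  rewrite sqrf_eq1 -(prim_order_dvd prim_z) dvdn_Pexp2l // ltnn.
  by move=> /eqP.
have [f [f_min mon_f] root_f] := minCpolyP z.
have size_f : size f = (2 ^ k).+1.
  rewrite -(size_map_poly (ratr : {rmorphism rat -> algC})) -f_min.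
  rewrite (minCpoly_cyclotomic prim_z) size_cyclotomic totient_pfactor //.
  by rewrite mul1n.
have f_p : f %= p.
  rewrite -dvdp_size_eqp ?size_f ?size_p // -root_f rmorphD rmorph1 /= map_polyXn.
  by rewrite rootE hornerD hornerXn hornerC zk addNr.
have nz_p : p != 0 by rewrite -size_poly_eq0 size_p.
split=> [|q size_q /dvdpP[r def_p]]; first by rewrite size_p ltnS.
have q_dvd : q %| p by rewrite def_p dvdp_mull.
have [nz_r nz_q] : r != 0 /\ q != 0.
  by apply/andP; rewrite -negb_or -mulf_eq0 -def_p.
have : root (map_poly ratr (r * q)) z by rewrite -def_p root_f (eqp_dvdl _ f_p).
rewrite rmorphM rootM !root_f !(eqp_dvdl _ f_p) => /orP[p_r | p_q].
  case/negP: size_q; have := dvdp_leq nz_r p_r.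
  rewrite def_p size_mul //; move: nz_q; rewrite -size_poly_gt0.
  case: (size q) => [|[|n]] // _; rewrite !addnS /= ltnNge leq_addr //.
by apply/andP.
Qed.

(** * Counting the components over the rationals and over a finite field *)

Theorem theorem3p1 (m : nat) (hm : (2 <= m)%N) (gT : finGroupType)
    (hG : ([set: gT] \isog Grp (t : x : y :
             t ^+ (2 ^ m), x ^+ 2, y ^+ 2, [~ t, x], [~ t, y],
             [~ x, y] = t ^+ (2 ^ m.-1)))%g) :
  (exists Fs Qs : seq {aspace group_alg rat gT},
     [/\ wedderburn_decomposition (Fs ++ Qs),
         size Fs = (4 * m)%N, size Qs = 1%N,
         forall B : {aspace group_alg rat gT}, B \in Fs ->
           field_alg (subvs_of B)
       & forall B : {aspace group_alg rat gT}, B \in Qs ->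
           quaternion_alg (subvs_of B)]) /\
  (forall K : finFieldType, odd #|K| ->
     (exists s : seq {aspace group_alg K gT}, wedderburn_decomposition s) /\
     (forall s : seq {aspace group_alg K gT}, wedderburn_decomposition s ->
        (8 * m - 10 <= size s)%N /\
        ((2 < m)%N -> #|K| = 3 %[mod 8] ->
           size s = (8 * m - 10)%N /\
           exists Fs Qs : seq {aspace group_alg K gT},
             [/\ perm_eq s (Fs ++ Qs),
                 size Fs = (8 * m - 12)%N, size Qs = 2%N,
                 forall B : {aspace group_alg K gT}, B \in Fs ->
                   field_alg (subvs_of B)
               & forall B : {aspace group_alg K gT}, B \in Qs ->
                   quaternion_alg (subvs_of B) /\
                   matrix2_alg (subvs_of B)]))).
Proof.
(* From here on the exponent of the statement is m + 1, and the central involution is t^(2^m). *)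
case: m hm hG => // m; rewrite ltnS /= => m_gt0 hG; split.
  have fac k : exists s, [/\ factorization ('X^(2 ^ k) + 1 : {poly rat}) s,
      (1 <= size s)%N & True -> size s = 1%N].
    exists [:: 'X^(2 ^ k) + 1]; split=> //.
    exact/factorization_irreducible/irreducible_X2k_add1_rat.
  have [Ps [facP _ /(_ I) sizeP]] := factorization_2power fac m.
  have [Qs [facQ _ /(_ I) sizeQ]] := fac m.
  have [//|Fs [Ms [decomp sizeF sizeM fieldF quatM]]] := d1_wedderburn _ hG facP facQ.
  exists Fs, Ms; split=> // [||B /quatM[]] //.
    by rewrite sizeF sizeP sum_nat_const card_ord muln1.
  by rewrite sizeM.
move=> K odd_K; have nz2 := odd_card_neq0 odd_K.
have fac k := factorization_finField k odd_K.
have [Ps [facP leP eqP]] := factorization_2power fac m.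
have [Qs [facQ leQ eqQ]] := fac m.
have [Fs [Ms [decomp sizeF sizeM fieldF quatM]]] := d1_wedderburn nz2 hG facP facQ.
(* X - 1, X + 1 and X^2 + 1 count once, the other m - 2 polynomials X^(2^i) + 1 twice; the number of
   components to reach is 4 (2 m - 1) + 2 = 8 (m + 1) - 10. *)
have sumE : (1 < m)%N -> (1 + \sum_(i < m) (1 < i).+1 = 2 * m - 1)%N.
  move=> m_gt1; rewrite -(subnK m_gt1) addn2.
  elim: (m - 2)%N => [|n IHn]; first by rewrite !big_ord_recr big_ord0.
  by rewrite big_ord_recr /= addnA IHn; lia.
(* By uniqueness of the decomposition it suffices to count the blocks of the one constructed. *)
split=> [|s /(wedderburn_perm decomp) perm_s]; first by exists (Fs ++ Ms).
have size_s : size s = (4 * size Ps + size Qs)%N.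
  by rewrite -(perm_size perm_s) size_cat sizeF sizeM.
split=> [|m_gt1 K3].
  rewrite size_s; have [m_gt1 | m_le1] := ltnP 1 m.
    by move: leP leQ; rewrite sumE // m_gt1; lia.
  (* In this case X^2 - 1 alone contributes at least 8 components, and the bound is 6. *)
  have m1 : m = 1%N by lia.
  by move: leP; rewrite m1 big_ord1 /=; lia.
rewrite ltnS in m_gt1; have := eqP K3; have := eqQ K3; rewrite sumE // m_gt1 => sizeQ sizeP.
split; first by rewrite size_s sizeQ sizeP; lia.
exists Fs, Ms; split=> //; first by rewrite perm_sym.
  by rewrite sizeF sizeP; lia.
by rewrite sizeM.
Qed.
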